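(* Let $(\mathbb W,\mathbb U,\widehat{\mathbb V},\mathbb F)$ be a braided multiplicative unitary, with $\mathbb W\in\mathcal U(\mathcal H\otimes\mathcal H)$, $\mathbb U\in\mathcal U(\mathcal L\otimes\mathcal H)$, $\widehat{\mathbb V}\in\mathcal U(\mathcal H\otimes\mathcal L)$, $\mathbb F\in\mathcal U(\mathcal L\otimes\mathcal L)$, and let $\mathbb W^C:=\mathbb W_{13}\mathbb U_{23}\widehat{\mathbb V}_{34}^*\mathbb F_{24}\widehat{\mathbb V}_{34}\in\mathcal U(\mathcal H\otimes\mathcal L\otimes\mathcal H\otimes\mathcal L)$, which is a multiplicative unitary on $\mathcal H\otimes\mathcal L$. The operators $\mathbb W_{13}\mathbb U_{23}\in\mathcal U(\mathcal H\otimes\mathcal L\otimes\mathcal H)$ and $\mathbb W_{12}\in\mathcal U(\mathcal H\otimes\mathcal H\otimes\mathcal L)$ are bicharacters from $\mathbb W^C$ to $\mathbb W$ and from $\mathbb W$ to $\mathbb W^C$, respectively, whose composite from $\mathbb W^C$ to itself is equal to $$\mathbb P:=\mathbb W_{13}\mathbb U_{23}\in\mathcal U(\mathcal H\otimes\mathcal L\otimes\mathcal H\otimes\mathcal L).$$ Equivalently, the following equations hold in $\mathcal U\bigl((\mathcal H\otimes\mathcal L)^{\otimes 3}\bigr)$, where legs refer to the factors $\mathcal H\otimes\mathcal L$: $$\mathbb P_{23}\mathbb W^C_{12}=\mathbb W^C_{12}\mathbb P_{13}\mathbb P_{23},\qquad \mathbb W^C_{23}\mathbb P_{12}=\mathbb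 P_{12}\mathbb P_{13}\mathbb W^C_{23},\qquad \mathbb P_{23}\mathbb P_{12}=\mathbb P_{12}\mathbb P_{13}\mathbb P_{23}.$$
   Context: Leg numbering notation is used; $\mathcal U(\cdot)$ denotes the unitary group. A multiplicative unitary is $\mathbb W\in\mathcal U(\mathcal H\otimes\mathcal H)$ with $\mathbb W_{23}\mathbb W_{12}=\mathbb W_{12}\mathbb W_{13}\mathbb W_{23}$. For multiplicative unitaries $\mathbb W^i\in\mathcal U(\mathcal H_i\otimes\mathcal H_i)$, a bicharacter from $\mathbb W^1$ to $\mathbb W^2$ is $X\in\mathcal U(\mathcal H_1\otimes\mathcal H_2)$ with $X_{23}\mathbb W^1_{12}=\mathbb W^1_{12}X_{13}X_{23}$ and $\mathbb W^2_{23}X_{12}=X_{12}X_{13}\mathbb W^2_{23}$. A unitary $P\in\mathcal U(\mathcal H_1\otimes\mathcal H_3)$ is the composite of bicharacters $X$ from $\mathbb W^1$ to $\mathbb W^2$ and $Y$ from $\mathbb W^2$ to $\mathbb W^3$ if $Y_{23}X_{12}=X_{12}P_{13}Y_{23}$ in $\mathcal U(\mathcal H_1\otimes\mathcal H_2\otimes\mathcal H_3)$ (this determines $P$ uniquely). A braided multiplicative unitary over $\mathbb W$ consists of a multiplicative unitary $\mathbb W\in\mathcal U(\mathcal H\otimes\mathcal H)$, a Hilbert space $\mathcal L$ and unitaries $\mathbb U\in\mathcal U(\mathcal L\otimes\mathcal H)$, $\widehat{\mathbb V}\in\mathcal U(\mathcal H\otimes\mathcal L)$, $\mathbb F\in\mathcal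 U(\mathcal L\otimes\mathcal L)$ such that: $\mathbb W_{23}\mathbb U_{12}=\mathbb U_{12}\mathbb U_{13}\mathbb W_{23}$; $\widehat{\mathbb V}_{23}\mathbb W_{12}=\mathbb W_{12}\widehat{\mathbb V}_{13}\widehat{\mathbb V}_{23}$; $\widehat{\mathbb V}_{12}\mathbb W_{13}\mathbb U_{23}=\mathbb U_{23}\mathbb W_{13}\widehat{\mathbb V}_{12}$ in $\mathcal U(\mathcal H\otimes\mathcal L\otimes\mathcal H)$; $\mathbb U_{13}\mathbb U_{23}\mathbb F_{12}=\mathbb F_{12}\mathbb U_{13}\mathbb U_{23}$ in $\mathcal U(\mathcal L\otimes\mathcal L\otimes\mathcal H)$; $\widehat{\mathbb V}_{13}\widehat{\mathbb V}_{12}\mathbb F_{23}=\mathbb F_{23}\widehat{\mathbb V}_{13}\widehat{\mathbb V}_{12}$ in $\mathcal U(\mathcal H\otimes\mathcal L\otimes\mathcal L)$; and $\mathbb F_{23}\mathbb F_{12}=\mathbb F_{12}(c_{\mathcal L,\mathcal L})_{23}\mathbb F_{12}(c_{\mathcal L,\mathcal L}^{-1})_{23}\mathbb F_{23}$ in $\mathcal U(\mathcal L\otimes\mathcal L\otimes\mathcal L)$. Here, for $\mathbb S\in\mathcal U(\mathcal K\otimes\mathcal H)$ with $\mathbb W_{23}\mathbb S_{12}=\mathbb S_{12}\mathbb S_{13}\mathbb W_{23}$ (a right representation of $\mathbb W$), $c_{\mathcal L,\mathcal K}=Z\Sigma\colon\mathcal L\otimes\mathcal K\to\mathcal K\otimes\mathcal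 L$, where $\Sigma$ is the flip and $Z\in\mathcal U(\mathcal K\otimes\mathcal L)$ is the unique unitary with $Z_{13}=\widehat{\mathbb V}_{23}\mathbb S_{12}^*\widehat{\mathbb V}_{23}^*\mathbb S_{12}$ in $\mathcal U(\mathcal K\otimes\mathcal H\otimes\mathcal L)$; existence of $Z$ for all right representations is part of the standing setup (it is automatic if $\mathbb W$ is manageable). For $c_{\mathcal L,\mathcal L}$ use $\mathbb S=\mathbb U$. *)

(* Defs.v *)
From HB Require Import structures.
From mathcomp Require Import all_boot all_order all_algebra.
From mathcomp Require Import complex.
From mathcomp Require Import all_classical all_reals interval_inference.
From mathcomp Require Import topology normedtype sequences.
From mathcomp Require Import ring.

Set Implicit Arguments.
Unset Strict Implicit.
Unset Printing Implicit Defensive.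

Import Order.TTheory GRing.Theory Num.Theory.
Import numFieldNormedType.Exports.

Local Open Scope ring_scope.
Local Open Scope classical_set_scope.

Section DotNorm.
Variables (C : numClosedFieldType) (U : lmodType C) (d : {dot U for Num.conj}).

Definition dotnorm u : C := sqrtC (d u u).

Lemma dotnorm_ge0 u : 0 <= dotnorm u. Proof. exact: sqrt_dnorm_ge0. Qed.

Lemma dotnorm_sqr u : dotnorm u ^+ 2 = d u u. Proof. exact: sqrtCK. Qed.

Lemma dot_conj u v : d u v = (d v u)^*.
Proof. by rewrite hermC/= mul1r. Qed.

Lemma dotnorm_CS u v : `|d u v| <= dotnorm u * dotnorm v.
Proof.
rewrite -(@ler_pXn2r _ 2) ?nnegrE ?mulr_ge0 ?dotnorm_ge0//.
rewrite exprMn !dotnorm_sqr.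
have [->|v0] := eqVneq v 0; first by rewrite !linear0r normr0 expr0n mulr0.
have dv0 : 0 < d v v by rewrite dnorm_gt0.
pose a := d u v / d v v.
have : 0 <= d (u - a *: v) (u - a *: v) by exact: dnorm_ge0.
rewrite dnormB dnormZ linearZr_LR/=.
have -> : (a)^* * d u v = `|d u v| ^+ 2 / d v v.
  by rewrite /a rmorphM/= fmorphV/= -[(d v v)^*]dot_conj normCK mulrAC [_^* * _]mulrC.
have -> : `|a| ^+ 2 * d v v = `|d u v| ^+ 2 / d v v.
  rewrite /a normrM normfV (ger0_norm (ltW dv0)) exprMn.
  by rewrite -mulrA; congr (_ * _); rewrite expr2 -mulrA mulVf ?gt_eqF// mulr1.
have -> : (`|d u v| ^+ 2 / d v v)^* = `|d u v| ^+ 2 / d v v.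
  by apply/CrealP; rewrite rpredM ?rpredV ?rpredX ?normr_real ?gtr0_real.
by rewrite opprD addrA addrK subr_ge0 ler_pdivrMr.
Qed.

Lemma dotnormD u v : dotnorm (u + v) <= dotnorm u + dotnorm v.
Proof.
rewrite -(@ler_pXn2r _ 2) ?nnegrE ?addr_ge0 ?dotnorm_ge0//.
rewrite sqrrD !dotnorm_sqr dnormD addrAC lerD2r// lerD2l.
have := leif_Re_Creal (d u v) => -[+ _].
move=> /le_trans/(_ (dotnorm_CS u v)).
by rewrite ReE ler_pdivrMr ?ltr0n// mulr_natr.
Qed.

Lemma dotnormZ a u : dotnorm (a *: u) = `|a| * dotnorm u.
Proof. by rewrite /dotnorm dnormZ sqrtCM ?nnegrE ?exprn_ge0 ?dnorm_ge0// sqrCK. Qed.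

Lemma dotnorm_eq0 u : dotnorm u = 0 -> u = 0.
Proof. by move=> /eqP; rewrite sqrt_dnorm_eq0 => /eqP. Qed.

Lemma dotnorm0 : dotnorm 0 = 0. Proof. by rewrite /dotnorm linear0l sqrtC0. Qed.

Lemma dotnormN u : dotnorm (- u) = dotnorm u.
Proof. by rewrite -scaleN1r dotnormZ normrN1 mul1r. Qed.

Lemma dotnormB u v : dotnorm (u - v) = dotnorm (v - u).
Proof. by rewrite -dotnormN opprB. Qed.

Lemma dot_suml I (r : seq I) (F : I -> U) v :
  d (\sum_(i <- r) F i) v = \sum_(i <- r) d (F i) v.
Proof.
by apply: (big_morph (fun u => d u v)) => [x y|]; rewrite ?linearDl ?linear0l.
Qed.

Lemma dot_sumr I (r : seq I) (F : I -> U) v :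
  d v (\sum_(i <- r) F i) = \sum_(i <- r) d v (F i).
Proof. by rewrite linear_sum. Qed.

End DotNorm.

(* The inner product '[x, y] is linear in x and conjugate-linear in y. *)
HB.mixin Record NormedModule_isInnerProduct (R : realType) V of NormedModule R[i]%C V := {
  hdot : {dot V for Num.conj};
  sqr_norm_hdot : forall x : V, `|x| ^+ 2 = hdot x x }.
#[short(type="hilbertType")]
HB.structure Definition Hilbert (R : realType) :=
  {V of CompleteNormedModule R[i]%C V & NormedModule_isInnerProduct R V}.
Notation "''[' x , y ]" := (hdot x y) : ring_scope.

Section NullSequences.
Variable R : realType.
Local Notation C := R[i]%C.
Implicit Types (a b : nat -> C) (e l : C).

Definition null_seq a := forall e, 0 < e -> \forall n \near \oo, `|a n| < e.

Lemma null_le a b : (forall n, `|a n| <= `|b n|) -> null_seq b -> null_seq a.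
Proof.
move=> ab b0 e e0; near=> n; apply: le_lt_trans (ab n) _.
by near: n; exact: b0.
Unshelve. all: by end_near. Qed.

Lemma nullD a b : null_seq a -> null_seq b -> null_seq (fun n => a n + b n).
Proof.
move=> a0 b0 e e0; have e2 : 0 < e / 2 by rewrite divr_gt0.
near=> n; rewrite (splitr e); apply: le_lt_trans (ler_normD _ _) _.
by apply: ltrD; near: n; [exact: a0|exact: b0].
Unshelve. all: by end_near. Qed.

Lemma null_shift a N : null_seq a -> null_seq (fun n => a (n + N)%N).
Proof.
move=> a0 e /a0[M _ aM]; exists M => // n /= Mn.
by apply: aM => /=; rewrite (leq_trans Mn)// leq_addr.
Qed.

Lemma nullN a : null_seq a -> null_seq (fun n => - a n).
Proof. by apply: null_le => n; rewrite normrN. Qed.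

Lemma nullM a b M : (forall n, `|a n| <= M) -> null_seq b -> null_seq (fun n => a n * b n).
Proof.
move=> aM b0 e e0.
have M0 : 0 <= M by exact: le_trans (normr_ge0 _) (aM 0%N).
have M1 : 0 < M + 1 by rewrite ltr_wpDl.
near=> n; rewrite normrM; apply: (@le_lt_trans _ _ ((M + 1) * `|b n|)).
  by rewrite ler_wpM2r// (le_trans (aM n))// lerDl.
by rewrite mulrC -ltr_pdivlMr//; near: n; apply: b0; rewrite divr_gt0.
Unshelve. all: by end_near. Qed.

Lemma null_cst l : null_seq (fun=> l) -> l = 0.
Proof.
move=> l0; apply/eqP; rewrite -normr_eq0; apply/negP => /negP ln0.
have lp : 0 < `|l| by rewrite lt_def ln0 normr_ge0.
near \oo => n.
have : `|l| < `|l| by near: n; exact: l0.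
by rewrite ltxx.
Unshelve. all: by end_near. Qed.

Lemma null_uniq a l l' : null_seq (fun n => a n - l) -> null_seq (fun n => a n - l') -> l = l'.
Proof.
move=> al al'; apply/eqP; rewrite -subr_eq0; apply/eqP/null_cst.
apply: null_le (nullD al' (nullN al)) => n.
by rewrite opprB [X in _ <= `|X|]addrC addrA subrK.
Qed.

Lemma null_conj a : null_seq a -> null_seq (fun n => (a n)^*).
Proof. by apply: null_le => n; rewrite norm_conjC. Qed.

Lemma null_ge0 a l : (forall n, 0 <= a n) -> null_seq (fun n => a n - l) -> 0 <= l.
Proof.
move=> a0 al.
have lr : l^* = l.
  apply: (@null_uniq a) => //; apply: null_le al => n.
  by rewrite -norm_conjC rmorphB/= conjCK (CrealP (ger0_real (a0 n))).
have {}lr : l \is Num.real by apply/CrealP.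
rewrite real_leNgt ?real0//; apply/negP => l0.
have nl : 0 < - l by rewrite oppr_gt0.
near \oo => n.
have : `|a n - l| < - l by near: n; exact: al.
rewrite ger0_norm ?addr_ge0 ?(ltW nl)// ltrBlDr addNr => /lt_le_trans/(_ (a0 n)).
by rewrite ltxx.
Unshelve. all: by end_near. Qed.

Definition cauchyC a := forall e, 0 < e ->
  exists N, forall m n, (N <= m)%N -> (N <= n)%N -> `|a m - a n| < e.

Lemma real_complex_gt0 e : 0 < e -> e = (complex.Re e)%:C%C /\ 0 < complex.Re e.
Proof.
move=> e0; split; last by move: e0; rewrite ltcE => /andP[].
by rewrite RRe_real// gtr0_real.
Qed.

Lemma null_inv : null_seq (fun n => n.+1%:R^-1).
Proof.
move=> e /real_complex_gt0[-> /posnumP[r]]; near=> n.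
rewrite ger0_norm ?invr_ge0 ?ler0n//.
have -> : (n.+1%:R^-1 : C) = (n.+1%:R^-1)%:C%C by rewrite fmorphV rmorph_nat.
by rewrite ltcR; near: n; exact: near_infty_natSinv_lt.
Unshelve. all: by end_near. Qed.

Lemma cauchy_real_cvg (a : nat -> R) :
  (forall e : R, 0 < e -> exists N, forall m n, (N <= m)%N -> (N <= n)%N -> `|a m - a n| < e) ->
  exists l : R, forall e : R, 0 < e -> \forall n \near \oo, `|a n - l| < e.
Proof.
move=> ca; have : cvg (a @ \oo).
  apply/cauchy_cvgP/cauchy_exP => e e0.
  have [N aN] := ca e e0; exists (a N); exists N => // n /= Nn.
  by rewrite -ball_normE/=; exact: aN.
move=> /cvg_ex[l /cvgrPdist_lt al]; exists l => e e0.
by near=> n; rewrite distrC; near: n; exact: al.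
Unshelve. all: by end_near. Qed.

Lemma norm_complex_le (x : C) : `|x| <= (`|complex.Re x| + `|complex.Im x|)%:C%C.
Proof.
rewrite [in leLHS](complexE x) (le_trans (ler_normD _ _))//.
rewrite normrM rmorphD/= lerD//.
  by rewrite normc_def/= expr0n addr0 sqrtr_sqr.
rewrite [X in X * _]normc_def/= expr0n expr1n add0r sqrtr1 mul1r.
by rewrite normc_def/= expr0n addr0 sqrtr_sqr.
Qed.

Lemma norm_Im_le (x : C) : `|complex.Im x|%:C%C <= `|x|.
Proof.
rewrite normc_def lecR -sqrtr_sqr ler_wsqrtr// lerDr sqr_ge0//.
Qed.

Lemma cauchyC_cvg a : cauchyC a -> exists l, null_seq (fun n => a n - l).
Proof.
move=> ca.
have [x ax] : exists x, forall e : R, 0 < e ->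
    \forall n \near \oo, `|complex.Re (a n) - x| < e.
  apply: cauchy_real_cvg => e; rewrite -ltcR => /ca[N aN]; exists N => m n Nm Nn.
  rewrite -ltcR -raddfB/=; apply: le_lt_trans (aN _ _ Nm Nn); exact: normc_ge_Re.
have [y ay] : exists y, forall e : R, 0 < e ->
    \forall n \near \oo, `|complex.Im (a n) - y| < e.
  apply: cauchy_real_cvg => e; rewrite -ltcR => /ca[N aN]; exists N => m n Nm Nn.
  rewrite -ltcR -raddfB/=; apply: le_lt_trans (aN _ _ Nm Nn); exact: norm_Im_le.
exists (x +i* y)%C => e /real_complex_gt0[-> e0].
have e2 : 0 < complex.Re e / 2 by rewrite divr_gt0.
near=> n; apply: le_lt_trans (norm_complex_le _) _; rewrite ltcR (splitr (complex.Re e)).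
rewrite !raddfB/=; apply: ltrD; near: n; [exact: ax|exact: ay].
Unshelve. all: by end_near. Qed.

End NullSequences.

(* The algebraic tensor product of H and K, realized as the space of finite-rank
   conjugate-linear maps K -> H; x (x) y is the map z |-> '[y, z] *: x. *)
Section AlgebraicTensor.
Variables (R : realType) (H K : hilbertType R).
Local Notation C := R[i]%C.
Implicit Types s t : seq (H * K).

Definition finrank_fun s : K -> H := fun y => \sum_(p <- s) '[p.2, y] *: p.1.

Definition finrank : {pred K -> H} := [pred f | `[< exists s, f = finrank_fun s >]].

Lemma finrank_cat s t y : finrank_fun (s ++ t) y = finrank_fun s y + finrank_fun t y.
Proof. by rewrite /finrank_fun big_cat. Qed.

Lemma finrank_scale a s y :
  finrank_fun [seq (a *: p.1, p.2) | p <- s] y = a *: finrank_fun s y.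
Proof.
rewrite /finrank_fun big_map scaler_sumr.
by apply: eq_bigr => p _; rewrite !scalerA mulrC.
Qed.

Lemma finrank_submod : submod_closed finrank.
Proof.
split=> [|a f g /asboolP[s ->] /asboolP[t ->]]; apply/asboolP.
  by exists [::]; apply/funext => y; rewrite /finrank_fun big_nil.
exists ([seq (a *: p.1, p.2) | p <- s] ++ t); apply/funext => y.
by rewrite finrank_cat finrank_scale.
Qed.

HB.instance Definition _ := GRing.isSubmodClosed.Build C (K -> H) finrank finrank_submod.

Definition alg_tensor := {f : K -> H | f \in finrank}.
HB.instance Definition _ := SubChoice.on alg_tensor.
HB.instance Definition _ := [SubChoice_isSubLmodule of alg_tensor by <:].

Definition fdot (f : K -> H) t : C := \sum_(p <- t) '[f p.2, p.1].

Lemma fdotC s t : fdot (finrank_fun s) t = (fdot (finrank_fun t) s)^*.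
Proof.
rewrite /fdot rmorph_sum/= /finrank_fun.
under eq_bigr do rewrite dot_suml/=.
under [RHS]eq_bigr do rewrite dot_suml/= rmorph_sum/=.
rewrite exchange_big/=; apply: eq_bigr => p _; apply: eq_bigr => q _.
rewrite !linearZl_LR/= rmorphM/= -!(dot_conj hdot); congr (_ * _).
Qed.

Lemma fdot_gram_schmidt n s : size s = n ->
  0 <= fdot (finrank_fun s) s /\ (fdot (finrank_fun s) s = 0 -> finrank_fun s = fun=> 0).
Proof.
elim: n s => [|n IH] [|[x y] s]//=; first by rewrite /fdot big_nil /finrank_fun;
  move=> _; split=> // _; apply/funext => z; rewrite big_nil.
move=> [sn].
have fE t t' : finrank_fun t = finrank_fun t' ->
    fdot (finrank_fun t) t = fdot (finrank_fun t') t'.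
  by move=> tt'; rewrite tt' fdotC tt' -fdotC.
have [y0|y0] := eqVneq y 0.
  have E : finrank_fun ((x, y) :: s) = finrank_fun s.
    by apply/funext => z; rewrite /finrank_fun big_cons/= y0 linear0l scale0r add0r.
  by rewrite (fE _ _ E) E; exact: IH.
pose c (p : H * K) := '[p.2, y] / '[y, y].
pose s' := [seq (p.1, p.2 - c p *: y) | p <- s].
pose x' := x + \sum_(p <- s) c p *: p.1.
have yy0 : '[y, y] != 0 by rewrite dnorm_eq0.
have sy : finrank_fun s' y = 0.
  rewrite /finrank_fun big_map big1// => p _ /=.
  by rewrite linearBl/= linearZl_LR/= /c divfK// subrr scale0r.
have E : finrank_fun ((x, y) :: s) = finrank_fun ((x', y) :: s').
  apply/funext => z; rewrite /finrank_fun !big_cons/= big_map scalerDr -addrA.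
  congr (_ + _); rewrite scaler_sumr -big_split/=; apply: eq_bigr => p _.
  rewrite scalerA -scalerDl linearBl/= linearZl_LR/=; congr (_ *: _).
  by rewrite addrC [_ * c p]mulrC subrK.
have Q : fdot (finrank_fun ((x', y) :: s')) ((x', y) :: s') =
    '[x', x'] * '[y, y] + fdot (finrank_fun s') s'.
  have cE t z : finrank_fun ((x', y) :: t) z = '[y, z] *: x' + finrank_fun t z.
    by rewrite /finrank_fun big_cons.
  rewrite /fdot big_cons/= cE sy addr0 linearZl_LR/= mulrC; congr (_ + _).
  rewrite /fdot.
  under eq_bigr do rewrite cE linearDl/=.
  rewrite big_split/= big_map/= big1 ?add0r// => p _ /=.
  rewrite linearZl_LR/= linearBr/= linearZr_LR/= rmorphM/= fmorphV/=.
  by rewrite -!(dot_conj hdot) divfK// subrr mul0r.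
have [Q0 Qe] := IH s' (ltac:(by rewrite size_map)).
rewrite (fE _ _ E) E Q; have xy0 : 0 <= '[x', x'] * '[y, y] by rewrite mulr_ge0 ?dnorm_ge0.
split; first exact: addr_ge0.
move=> /eqP; rewrite paddr_eq0// mulf_eq0 (negPf yy0) orbF dnorm_eq0 => /andP[/eqP x0 /eqP/Qe s0].
apply/funext => z.
rewrite /finrank_fun big_cons/= x0 scaler0 add0r.
by have := congr1 (fun f => f z) s0; rewrite /finrank_fun.
Qed.

Lemma finrankP (f : alg_tensor) : exists s, val f = finrank_fun s.
Proof. by case: f => f /= /asboolP. Qed.

Definition alg_rep (f : alg_tensor) : seq (H * K) := sval (cid (finrankP f)).

Lemma alg_repE f : val f = finrank_fun (alg_rep f).
Proof. exact: svalP (cid (finrankP f)). Qed.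

Definition alg_dot (f g : alg_tensor) : C := fdot (val f) (alg_rep g).

Lemma alg_dotE f g t : val g = finrank_fun t -> alg_dot f g = fdot (val f) t.
Proof. by move=> gt; rewrite /alg_dot alg_repE fdotC -alg_repE gt -fdotC. Qed.

Lemma alg_dotC f g : alg_dot f g = (alg_dot g f)^*.
Proof. by rewrite /alg_dot !alg_repE fdotC. Qed.

Lemma alg_dot_linear g a f f' : alg_dot (a *: f + f') g = a * alg_dot f g + alg_dot f' g.
Proof.
rewrite /alg_dot /fdot mulr_sumr -big_split/=; apply: eq_bigr => p _.
rewrite -[LHS]/('[a *: val f p.2 + val f' p.2, p.1]).
by rewrite linearDl/= linearZl_LR.
Qed.

Lemma alg_dot_bilinear :
  bilinear_for (GRing.Scale.Law.clone _ _ *%R _)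
    (GRing.Scale.Law.clone _ _ (Num.conj \; *%R) _) alg_dot.
Proof.
split=> [g a f f'|f a g g'] /=; first exact: alg_dot_linear.
by rewrite alg_dotC alg_dot_linear rmorphD rmorphM/= -!alg_dotC.
Qed.
HB.instance Definition _ := bilinear_isBilinear.Build _ _ _ _ _ _ alg_dot alg_dot_bilinear.

Lemma alg_dot_hermitian f g : alg_dot f g = (-1) ^+ false * (alg_dot g f)^*.
Proof. by rewrite mul1r alg_dotC. Qed.
HB.instance Definition _ := isHermitianSesquilinear.Build _ _ _ _ alg_dot alg_dot_hermitian.

Lemma alg_dot_gt0 f : f != 0 -> 0 < alg_dot f f.
Proof.
have [Q0 Qe] := fdot_gram_schmidt (erefl (size (alg_rep f))).
move=> f0; rewrite lt_def; apply/andP; split; last by rewrite /alg_dot alg_repE.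
apply: contra f0 => /eqP; rewrite /alg_dot alg_repE => /Qe fE.
by apply/eqP/val_inj; rewrite alg_repE fE.
Qed.
HB.instance Definition _ := isDotProduct.Build _ _ alg_dot alg_dot_gt0.
End AlgebraicTensor.

(* The completion of an inner product space V, realized as the space of the
   functionals w |-> lim_n '[u_n, w] for Cauchy sequences u in V. *)
Section Completion.
Variables (R : realType).
Local Notation C := R[i]%C.
Variables (V : lmodType C) (d : {dot V for Num.conj}).
Local Notation nm := (dotnorm d).
Implicit Types (u v : nat -> V).

Definition cauchyV u := forall e, 0 < e ->
  exists N, forall m n, (N <= m)%N -> (N <= n)%N -> nm (u m - u n) < e.

Definition represents u (f : V -> C) := cauchyV u /\ forall w, null_seq (fun n => d (u n) w - f w).

Lemma cauchyV_bounded u : cauchyV u -> exists2 M, 0 < M & forall n, nm (u n) <= M.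
Proof.
move=> /(_ 1 ltr01)[N uN]; have s0 k : 0 <= \sum_(i < k) nm (u i).
  by rewrite sumr_ge0// => i _; exact: dotnorm_ge0.
exists (\sum_(i < N.+1) nm (u i) + 1); first by rewrite ltr_wpDl.
move=> n; have [nN|Nn] := ltnP n N.+1.
  rewrite (bigD1 (Ordinal nN))//= -addrA lerDl addr_ge0//.
  by rewrite sumr_ge0// => i _; exact: dotnorm_ge0.
rewrite -[u n](subrK (u N)) addrC (le_trans (dotnormD _ _ _))// lerD//.
  by rewrite big_ord_recr/= lerDr; exact: s0.
by rewrite ltW// uN// ltnW.
Qed.

Lemma cauchyV_lin a u v : cauchyV u -> cauchyV v -> cauchyV (fun n => a *: u n + v n).
Proof.
move=> cu cv e e0; have a0 : 0 < `|a| + 1 by rewrite ltr_wpDl.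
have [N uN] := cu (e / 2 / (`|a| + 1)) (divr_gt0 (divr_gt0 e0 (ltr0n _ 2)) a0).
have [N' vN] := cv (e / 2) (divr_gt0 e0 (ltr0n _ 2)).
exists (maxn N N') => m n; rewrite !geq_max => /andP[Nm Nm'] /andP[Nn Nn'].
rewrite opprD addrACA -scalerBr (splitr e) (le_lt_trans (dotnormD _ _ _))//.
apply: ler_ltD; last exact: vN.
rewrite dotnormZ (@le_trans _ _ ((`|a| + 1) * nm (u m - u n)))//.
  by rewrite ler_wpM2r ?dotnorm_ge0// lerDl.
by rewrite mulrC -ler_pdivlMr// ltW// uN.
Qed.

Lemma cauchyV_cst x : cauchyV (fun=> x).
Proof. by move=> e e0; exists 0%N => *; rewrite subrr dotnorm0. Qed.

Lemma cauchyV_dot u v : cauchyV u -> cauchyV v -> cauchyC (fun n => d (u n) (v n)).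
Proof.
move=> cu cv e e0.
have [M M0 uM] := cauchyV_bounded cu; have [M' M'0 vM] := cauchyV_bounded cv.
have [N uN] := cu (e / 2 / M') (divr_gt0 (divr_gt0 e0 (ltr0n _ 2)) M'0).
have [N' vN] := cv (e / 2 / M) (divr_gt0 (divr_gt0 e0 (ltr0n _ 2)) M0).
exists (maxn N N') => m n; rewrite !geq_max => /andP[Nm Nm'] /andP[Nn Nn'].
have -> : d (u m) (v m) - d (u n) (v n) = d (u m - u n) (v m) + d (u n) (v m - v n).
  by rewrite linearBl linearBr/= addrA subrK.
rewrite (splitr e) (le_lt_trans (ler_normD _ _))//; apply: ltrD.
  apply: le_lt_trans (dotnorm_CS _ _ _) _.
  apply: (@le_lt_trans _ _ (nm (u m - u n) * M')).
    by rewrite ler_wpM2l ?dotnorm_ge0.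
  by rewrite -ltr_pdivlMr// uN.
apply: le_lt_trans (dotnorm_CS _ _ _) _.
apply: (@le_lt_trans _ _ (M * nm (v m - v n))).
  by rewrite ler_wpM2r ?dotnorm_ge0.
by rewrite mulrC -ltr_pdivlMr// vN.
Qed.

Lemma norm_dotnorm x : `|nm x| = nm x. Proof. by rewrite ger0_norm ?dotnorm_ge0. Qed.

Lemma null_dotl u v : cauchyV v -> null_seq (fun n => nm (u n)) -> null_seq (fun n => d (u n) (v n)).
Proof.
move=> /cauchyV_bounded[M M0 vM] u0.
have : null_seq (fun n => nm (v n) * nm (u n)).
  by apply: (@nullM _ _ _ M) => // n; rewrite norm_dotnorm.
by apply: null_le => n; rewrite normrM !norm_dotnorm mulrC dotnorm_CS.
Qed.

Lemma null_dotr u v : cauchyV u -> null_seq (fun n => nm (v n)) -> null_seq (fun n => d (u n) (v n)).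
Proof.
move=> cu v0; apply: null_le (null_conj (null_dotl cu v0)) => n.
by rewrite -dot_conj.
Qed.

Lemma null_dotnorm u : null_seq (fun n => d (u n) (u n)) -> null_seq (fun n => nm (u n)).
Proof.
move=> u0 e e0; near=> n.
rewrite norm_dotnorm -(@ltr_pXn2r _ 2) ?nnegrE ?dotnorm_ge0 ?ltW// dotnorm_sqr.
rewrite -[ltLHS]ger0_norm ?dnorm_ge0//.
by near: n; apply: u0; rewrite exprn_gt0.
Unshelve. all: by end_near. Qed.

Lemma weak_null u : cauchyV u -> (forall w, null_seq (fun n => d (u n) w)) ->
  null_seq (fun n => nm (u n)).
Proof.
move=> cu uw; apply: null_dotnorm => e e0.
have [M M0 uM] := cauchyV_bounded cu.
have [N uN] := cu (e / 2 / M) (divr_gt0 (divr_gt0 e0 (ltr0n _ 2)) M0).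
near=> n.
have -> : d (u n) (u n) = d (u n) (u n - u N) + d (u n) (u N).
  by rewrite linearBr/= subrK.
rewrite (splitr e) (le_lt_trans (ler_normD _ _))//; apply: ltrD.
  apply: le_lt_trans (dotnorm_CS _ _ _) _.
  apply: (@le_lt_trans _ _ (M * nm (u n - u N))).
    by rewrite ler_wpM2r ?dotnorm_ge0.
  rewrite mulrC -ltr_pdivlMr// uN//.
  by near: n; exact: nbhs_infty_ge.
by near: n; apply: uw; rewrite divr_gt0.
Unshelve. all: by end_near. Qed.

Lemma represents_lin a u v (f g : V -> C) : represents u f -> represents v g ->
  represents (fun n => a *: u n + v n) (fun w => a * f w + g w).
Proof.
move=> [cu uf] [cv vg]; split; first exact: cauchyV_lin.
move=> w; have : null_seq (fun n => a * (d (u n) w - f w) + (d (v n) w - g w)).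
  by apply: nullD => //; apply: (@nullM _ (fun=> a) _ `|a|).
apply: null_le => n; rewrite linearDl/= linearZl_LR/=.
by rewrite mulrBr opprD addrACA.
Qed.

Lemma represents_uniq u v (f : V -> C) : represents u f -> represents v f ->
  null_seq (fun n => nm (u n - v n)).
Proof.
move=> [cu uf] [cv vf].
have uvE n : u n - v n = (-1) *: v n + u n by rewrite scaleN1r addrC.
apply: weak_null => [|w]; first by under eq_fun do rewrite uvE; exact: cauchyV_lin.
apply: null_le (nullD (uf w) (nullN (vf w))) => n.
by rewrite linearBl/= opprB addrA subrK.
Qed.

Definition completion_pred : {pred V -> C} := [pred f | `[< exists u, represents u f >]].

Lemma completion_submod :
  submod_closed (completion_pred : {pred V -> C^o}).
Proof.
split=> [|a f g /asboolP[u uf] /asboolP[v vg]]; apply/asboolP.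
  exists (fun=> 0); split; first exact: cauchyV_cst.
  by move=> w e e0; near=> n; rewrite linear0l subrr normr0.
by exists (fun n => a *: u n + v n); exact: represents_lin.
Unshelve. all: by end_near. Qed.

HB.instance Definition _ :=
  GRing.isSubmodClosed.Build C (V -> C^o) completion_pred completion_submod.

Definition completion := {f : V -> C^o | f \in completion_pred}.
HB.instance Definition _ := SubChoice.on completion.
HB.instance Definition _ := [SubChoice_isSubLmodule of completion by <:].

Implicit Types (f g : completion).

Lemma completionP (f : completion) : exists u, represents u (val f).
Proof. by case: f => f /= /asboolP. Qed.

Lemma cdot_ex (f g : completion) : exists l, forall u v,
  represents u (val f) -> represents v (val g) -> null_seq (fun n => d (u n) (v n) - l).
Proof.
have [u0 uf0] := completionP f; have [v0 vg0] := completionP g.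
have [l ul] := cauchyC_cvg (cauchyV_dot (proj1 uf0) (proj1 vg0)).
exists l => u v uf vg.
have duv : null_seq (fun n => d (u n - u0 n) (v n)).
  by apply: null_dotl; [case: vg|exact: represents_uniq uf uf0].
have duv0 : null_seq (fun n => d (u0 n) (v n - v0 n)).
  by apply: null_dotr; [case: uf0|exact: represents_uniq vg vg0].
apply: null_le (nullD (nullD duv duv0) ul) => n.
by rewrite linearBl linearBr/= !addrA !subrK.
Qed.

Definition cdot (f g : completion) : C := sval (cid (cdot_ex f g)).

Lemma cdotE f g u v : represents u (val f) -> represents v (val g) ->
  null_seq (fun n => d (u n) (v n) - cdot f g).
Proof. exact: (svalP (cid (cdot_ex f g))). Qed.

Lemma cdot_conj f g : cdot f g = (cdot g f)^*.
Proof.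
have [u uf] := completionP f; have [v vg] := completionP g.
apply: null_uniq (cdotE uf vg) _.
apply: null_le (null_conj (cdotE vg uf)) => n.
by rewrite rmorphB/= -dot_conj.
Qed.

Lemma cdot_linear g a f f' : cdot (a *: f + f') g = a * cdot f g + cdot f' g.
Proof.
have [u uf] := completionP f; have [u' uf'] := completionP f'.
have [v vg] := completionP g.
apply: null_uniq (cdotE (represents_lin a uf uf' : represents _ (val (a *: f + f'))) vg) _.
have an : null_seq (fun n => a * (d (u n) (v n) - cdot f g)).
  by apply: (@nullM _ (fun=> a) _ `|a|) => //; exact: cdotE.
apply: null_le (nullD an (cdotE uf' vg)) => n.
by rewrite linearDl/= linearZl_LR/= mulrBr opprD addrACA.
Qed.

Lemma cdot_bilinear :
  bilinear_for (GRing.Scale.Law.clone _ _ *%R _)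
    (GRing.Scale.Law.clone _ _ (Num.conj \; *%R) _) cdot.
Proof.
split=> [g a f f'|f a g g'] /=; first exact: cdot_linear.
by rewrite cdot_conj cdot_linear rmorphD rmorphM/= -!cdot_conj.
Qed.
HB.instance Definition _ := bilinear_isBilinear.Build _ _ _ _ _ _ cdot cdot_bilinear.

Lemma cdot_hermitian f g : cdot f g = (-1) ^+ false * (cdot g f)^*.
Proof. by rewrite mul1r cdot_conj. Qed.
HB.instance Definition _ := isHermitianSesquilinear.Build _ _ _ _ cdot cdot_hermitian.

Lemma cdot_gt0 f : f != 0 -> 0 < cdot f f.
Proof.
have [u uf] := completionP f => f0.
have ul := cdotE uf uf.
rewrite lt_def (null_ge0 _ ul) ?andbT; last by move=> n; exact: dnorm_ge0.
apply: contra f0 => /eqP ff0; apply/eqP/val_inj/funext => w /=.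
rewrite ff0 in ul.
have u0 : null_seq (fun n => nm (u n)).
  by apply: null_dotnorm; apply: null_le ul => n; rewrite subr0.
apply: null_uniq (uf.2 w) _; apply: null_le (null_dotl (cauchyV_cst w) u0) => n.
by rewrite subr0.
Qed.
HB.instance Definition _ := isDotProduct.Build _ _ cdot cdot_gt0.

Lemma represents_embed x : represents (fun=> x) (d x).
Proof.
split; first exact: cauchyV_cst.
by move=> w e e0; near=> n; rewrite subrr normr0.
Unshelve. all: by end_near. Qed.

Lemma embed_subproof x : (d x : V -> C^o) \in completion_pred.
Proof. by apply/asboolP; exists (fun=> x); exact: represents_embed. Qed.

Definition embed x : completion := exist _ (d x : V -> C^o) (embed_subproof x).

Lemma embed_linear : linear embed.
Proof.
move=> a x y; apply/val_inj/funext => w /=.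
by rewrite linearDl/= linearZl_LR.
Qed.

Lemma cdot_embed x y : cdot (embed x) (embed y) = d x y.
Proof.
apply/eqP; rewrite eq_sym -subr_eq0; apply/eqP.
exact: null_cst (cdotE (represents_embed x : represents _ (val (embed x)))
  (represents_embed y : represents _ (val (embed y)))).
Qed.

Lemma represents_cvg u f : represents u (val f) -> forall e, 0 < e ->
  exists N, forall n, (N <= n)%N -> dotnorm cdot (f - embed (u n)) < e.
Proof.
move=> uf e e0; have e2 : 0 < e / 2 by rewrite divr_gt0.
have [N uN] := uf.1 _ e2; exists N => n Nn.
apply: (@le_lt_trans _ _ (e / 2)); last by rewrite gtr_pMr// invf_lt1 ?ltr1n.
rewrite -(@ler_pXn2r _ 2) ?nnegrE ?dotnorm_ge0 ?(ltW e2)// dotnorm_sqr.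
have rf : represents (fun m => u m - u n) (val (f - embed (u n))).
  have := represents_lin (-1) (represents_embed (u n)) uf.
  congr represents; apply/funext => m; first by rewrite scaleN1r addrC.
  by rewrite /= mulN1r addrC.
have /= rff := null_shift N (cdotE rf rf).
rewrite -subr_ge0; apply: (@null_ge0 _ (fun m => (e / 2) ^+ 2 - d (u (m + N)%N - u n) (u (m + N)%N - u n))).
  move=> m; rewrite subr_ge0 -dotnorm_sqr ler_pXn2r ?nnegrE ?dotnorm_ge0 ?(ltW e2)//.
  by rewrite ltW// uN// leq_addl.
apply: null_le (nullN rff) => m.
by rewrite opprB opprB addrAC addrCA subrr addr0 addrC.
Qed.

Lemma embed_dense f e : 0 < e -> exists x, dotnorm cdot (f - embed x) < e.
Proof.
move=> e0; have [u uf] := completionP f.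
by have [N /(_ N (leqnn _))] := represents_cvg uf e0; exists (u N).
Qed.

Lemma completion_complete (F : nat -> completion) :
  (forall e, 0 < e -> exists N, forall m n, (N <= m)%N -> (N <= n)%N ->
     dotnorm cdot (F m - F n) < e) ->
  exists f, null_seq (fun n => dotnorm cdot (F n - f)).
Proof.
move=> cF.
have n0 n : 0 < n.+1%:R^-1 :> C by rewrite invr_gt0 ltr0n.
pose u n := sval (cid (embed_dense (F n) (n0 n))).
have uE n : dotnorm cdot (F n - embed (u n)) < n.+1%:R^-1.
  exact: svalP (cid (embed_dense (F n) (n0 n))).
have Fu : null_seq (fun n => dotnorm cdot (F n - embed (u n))).
  apply: null_le (@null_inv R) => n.
  rewrite !ger0_norm ?dotnorm_ge0 ?(ltW (n0 n))//; exact/ltW/uE.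
have embedB x y : embed (x - y) = embed x - embed y.
  by rewrite -[x - y]addrC -scaleN1r embed_linear scaleN1r addrC.
have emn x : dotnorm cdot (embed x) = nm x by rewrite /dotnorm/= cdot_embed.
have cu : cauchyV u.
  move=> e e0; have e3 : 0 < e / 3 by rewrite divr_gt0// ltr0n.
  have [N FN] := cF _ e3; have [N' _ uN] := Fu _ e3.
  exists (maxn N N') => m n; rewrite !geq_max => /andP[Nm Nm'] /andP[Nn Nn'].
  have {}uN k : (N' <= k)%N -> dotnorm cdot (F k - embed (u k)) < e / 3.
    by move=> /uN/=; rewrite ger0_norm ?dotnorm_ge0.
  rewrite -emn embedB.
  have -> : embed (u m) - embed (u n) =
      (embed (u m) - F m) + (F m - F n) + (F n - embed (u n)).
    by rewrite !addrA !subrK.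
  have -> : e = e / 3 + e / 3 + e / 3.
    by field.
  apply: le_lt_trans (dotnormD _ _ _) _; apply: ltrD; last exact: uN.
  apply: le_lt_trans (dotnormD _ _ _) _; apply: ltrD; last exact: FN.
  by rewrite dotnormB uN.
have [f uf] : exists f : completion, represents u (val f).
  have fP w := cauchyC_cvg (cauchyV_dot cu (cauchyV_cst w)).
  pose f w : C^o := sval (cid (fP w)).
  have fE : represents u f by split=> // w; exact: svalP (cid (fP w)).
  have fm : f \in completion_pred by apply/asboolP; exists u.
  by exists (exist _ f fm).
exists f => e e0; have e2 : 0 < e / 2 by rewrite divr_gt0.
have [N uN] := represents_cvg uf e2.
near=> n; rewrite ger0_norm ?dotnorm_ge0//.
rewrite -(subrK (embed (u n)) (F n)) -addrA (splitr e).
apply: le_lt_trans (dotnormD _ _ _) _; apply: ltrD.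
  rewrite -[ltLHS]ger0_norm ?dotnorm_ge0//; near: n; exact: Fu.
by rewrite dotnormB uN//; near: n; exact: nbhs_infty_ge.
Unshelve. all: by end_near. Qed.

End Completion.

Section CauchyFilters.
Variables (R : realType) (V : normedModType R[i]%C).

Lemma seq_complete :
  (forall F : nat -> V, (forall e : R[i]%C, 0 < e -> exists N, forall m n,
     (N <= m)%N -> (N <= n)%N -> `|F m - F n| < e) ->
     exists x, null_seq (fun n => `|F n - x|)) ->
  forall F : set_system V, ProperFilter F -> cauchy F -> cvg F.
Proof.
move=> sc F FF /cauchyP cF.
have n0 n : 0 < n.+1%:R^-1 :> R[i]%C by rewrite invr_gt0 ltr0n.
pose x n := sval (cid (cF _ (n0 n))).
have xE n : F (ball (x n) n.+1%:R^-1) by exact: svalP (cid (cF _ (n0 n))).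
have [l xl] : exists l, null_seq (fun n => `|x n - l|).
  apply: sc => e e0; have e2 : 0 < e / 2 by rewrite divr_gt0.
  have [N _ Ne] := @null_inv R _ e2; exists N => m n Nm Nn.
  have xy k : (N <= k)%N -> F (ball (x k) (e / 2)).
    move=> /Ne; rewrite /= ger0_norm ?(ltW (n0 k))// => ke.
    by apply: filterS (xE k); apply: le_ball; exact: ltW.
  have /filter_ex[y []] : F (ball (x m) (e / 2) `&` ball (x n) (e / 2)).
    by apply: filterI; exact: xy.
  rewrite -ball_normE/= => my ny.
  rewrite -(subrK y (x m)) -addrA (splitr e) (le_lt_trans (ler_normD _ _))// ltrD//.
  by rewrite distrC.
apply/cvg_ex; exists l; apply/cvgrPdist_lt => e e0.
have e2 : 0 < e / 2 by rewrite divr_gt0.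
near \oo => n.
have xln : `|x n - l| < e / 2.
  by rewrite -normr_id; near: n; exact: xl.
have ne : n.+1%:R^-1 < e / 2 :> R[i]%C.
  rewrite -[ltLHS]ger0_norm ?(ltW (n0 n))//; near: n; exact: null_inv.
apply: filterS (xE n) => y; rewrite -ball_normE/= => xy.
rewrite -(subrK (x n) l) -addrA (splitr e) (le_lt_trans (ler_normD _ _))// ltrD//.
  by rewrite distrC.
exact: lt_trans xy ne.
Unshelve. all: by end_near. Qed.

End CauchyFilters.

Section HilbertCompletion.
Variables (R : realType) (V : lmodType R[i]%C) (d : {dot V for Num.conj}).

HB.instance Definition _ := Lmodule_isNormed.Build R[i]%C (completion d)
  (@dotnormD _ _ (@cdot _ _ d)) (@dotnormZ _ _ (@cdot _ _ d)) (@dotnorm_eq0 _ _ (@cdot _ _ d)).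

HB.instance Definition _ := Uniform_isComplete.Build (completion d)
  (seq_complete (@completion_complete _ _ d)).

HB.instance Definition _ := NormedModule_isInnerProduct.Build R (completion d)
  (@dotnorm_sqr _ _ (@cdot _ _ d)).
End HilbertCompletion.

Section Unitary.
Variable R : realType.
Local Notation C := R[i]%C.

Record unitary (H K : hilbertType R) := Unitary {
  unitary_fun :> H -> K;
  unitary_linear : linear unitary_fun;
  unitary_dot : forall x y, '[unitary_fun x, unitary_fun y] = '[x, y];
  unitary_surj : forall y, exists x, unitary_fun x = y }.

Section Approximation.
Variables (H : hilbertType R) (I : Type) (e : I -> H).

Definition lin_comb (s : seq (C * I)) : H := \sum_(p <- s) p.1 *: e p.2.

Definition in_closed_span (z : H) := forall r : C, 0 < r -> exists s, `|z - lin_comb s| < r.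

Definition densely_spans := forall z, in_closed_span z.

Definition scale_comb (a : C) (s : seq (C * I)) := [seq (a * p.1, p.2) | p <- s].

Lemma comb_scale a s : lin_comb (scale_comb a s) = a *: lin_comb s.
Proof. by rewrite /lin_comb big_map scaler_sumr; under eq_bigr do rewrite -scalerA. Qed.

Lemma comb_cat s t : lin_comb (s ++ t) = lin_comb s + lin_comb t.
Proof. by rewrite /lin_comb big_cat. Qed.

Lemma comb1 i : lin_comb [:: (1, i)] = e i.
Proof. by rewrite /lin_comb big_seq1 scale1r. Qed.

Lemma approx_limit z :
  (forall r : C, 0 < r -> exists2 z', in_closed_span z' & `|z - z'| < r) -> in_closed_span z.
Proof.
move=> az r r0; have r2 : 0 < r / 2 by rewrite divr_gt0.
have [z' /(_ _ r2)[s z's] zz'] := az _ r2; exists s.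
rewrite -(subrK z' z) -addrA (splitr r) (le_lt_trans (ler_normD _ _))//.
exact: ltrD.
Qed.

Lemma approx_lin a x y : in_closed_span x -> in_closed_span y -> in_closed_span (a *: x + y).
Proof.
move=> ax ay r r0; have a0 : 0 < `|a| + 1 by rewrite ltr_wpDl.
have [s xs] := ax (r / 2 / (`|a| + 1)) (divr_gt0 (divr_gt0 r0 (ltr0n _ 2)) a0).
have [t yt] := ay (r / 2) (divr_gt0 r0 (ltr0n _ 2)).
exists (scale_comb a s ++ t); rewrite comb_cat comb_scale opprD addrACA -scalerBr.
rewrite (splitr r) (le_lt_trans (ler_normD _ _))//; apply: ler_ltD => //.
rewrite normrZ (@le_trans _ _ ((`|a| + 1) * `|x - lin_comb s|))//.
  by rewrite ler_wpM2r// lerDl.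
by rewrite mulrC -ler_pdivlMr// ltW.
Qed.

Lemma approx0 : in_closed_span 0.
Proof. by move=> r r0; exists [::]; rewrite /lin_comb big_nil subrr normr0. Qed.

Lemma approx_sum J (r : seq J) (F : J -> H) :
  (forall j, in_closed_span (F j)) -> in_closed_span (\sum_(j <- r) F j).
Proof.
move=> aF; elim: r => [|j r IH]; first by rewrite big_nil; exact: approx0.
by rewrite big_cons -[F j]scale1r; exact: approx_lin.
Qed.

Lemma approx1 i : in_closed_span (e i).
Proof. by move=> r r0; exists [:: (1, i)]; rewrite comb1 subrr normr0. Qed.

End Approximation.

Lemma total_trans (H : hilbertType R) I J (e : I -> H) (f : J -> H) :
  densely_spans e -> (forall i, in_closed_span f (e i)) -> densely_spans f.
Proof.
move=> te fe z; apply: approx_limit => r r0; have [s zs] := te z _ r0.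
exists (lin_comb e s) => //; apply: approx_sum => p.
by rewrite -[_ *: _]addr0; apply: approx_lin => //; exact: approx0.
Qed.

Section Extension.
Variables (H K : hilbertType R) (I : Type) (e : I -> H) (f : I -> K).
Hypothesis gram : forall i j, '[f i, f j] = '[e i, e j].

Lemma comb_dot s t : '[lin_comb f s, lin_comb f t] = '[lin_comb e s, lin_comb e t].
Proof.
rewrite /lin_comb !dot_suml; apply: eq_bigr => p _; rewrite !dot_sumr.
by apply: eq_bigr => q _; rewrite !linearZl_LR !linearZr_LR/= gram.
Qed.

Lemma comb_dist s t : `|lin_comb f s - lin_comb f t| = `|lin_comb e s - lin_comb e t|.
Proof.
have E (L : hilbertType R) (g : I -> L) : lin_comb g s - lin_comb g t = lin_comb g (s ++ scale_comb (-1) t).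
  by rewrite comb_cat comb_scale scaleN1r.
by apply/eqP; rewrite !E -(@eqrXn2 _ 2)// !sqr_norm_hdot comb_dot.
Qed.

Definition ext_rel z w := forall r : C, 0 < r ->
  exists s, `|z - lin_comb e s| < r /\ `|w - lin_comb f s| < r.

Lemma ext_rel_ex z : in_closed_span e z -> exists w, ext_rel z w.
Proof.
move=> az; have n0 n : 0 < n.+1%:R^-1 :> C by rewrite invr_gt0 ltr0n.
pose s n := sval (cid (az _ (n0 n))).
have sE n : `|z - lin_comb e (s n)| < n.+1%:R^-1 by exact: svalP (cid (az _ (n0 n))).
have cvg_s : cvg ((fun n => lin_comb f (s n)) @ \oo).
  apply/cauchy_cvgP/cauchy_exP => r r0; have r2 : 0 < r / 2 by rewrite divr_gt0.
  have [N _ Nr] := @null_inv R _ r2.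
  have {}Nr n : (N <= n)%N -> `|z - lin_comb e (s n)| < r / 2.
    move=> /Nr/=; rewrite ger0_norm ?(ltW (n0 n))//; exact: lt_trans.
  exists (lin_comb f (s N)); exists N => // n /= Nn; rewrite -ball_normE/= comb_dist.
  rewrite -(subrK z (lin_comb e (s N))) -addrA (splitr r) (le_lt_trans (ler_normD _ _))//.
  by rewrite ltrD//; [rewrite distrC|]; exact: Nr.
move: cvg_s => /cvg_ex[w /cvgrPdist_lt sw]; exists w => r r0.
near \oo => n; exists (s n); split; last by near: n; exact: sw.
apply: lt_trans (sE n) _.
by rewrite -[ltLHS]ger0_norm ?(ltW (n0 n))//; near: n; exact: null_inv.
Unshelve. all: by end_near. Qed.

Lemma dist3 (L : hilbertType R) (a b c d : L) :
  `|a - b| <= `|a - c| + `|c - d| + `|d - b|.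
Proof.
have -> : a - b = (a - c) + (c - d) + (d - b) by rewrite !addrA !subrK.
apply: le_trans (ler_normD _ _) _; rewrite lerD2r; exact: ler_normD.
Qed.

Lemma ext_rel_dist x y z w : ext_rel x z -> ext_rel y w -> `|z - w| <= `|x - y|.
Proof.
move=> xz yw; apply/ler_addgt0Pr => r r0.
have r4 : 0 < r / 4 by rewrite divr_gt0// ltr0n.
have [s [xs zs]] := xz _ r4; have [t [yt wt]] := yw _ r4.
apply: le_trans (dist3 _ _ (lin_comb f s) (lin_comb f t)) _.
have -> : `|x - y| + r = r / 4 + (r / 4 + `|x - y| + r / 4) + r / 4 by field.
apply: lerD; last by rewrite distrC ltW.
apply: lerD; first exact: ltW.
rewrite comb_dist; apply: le_trans (dist3 _ _ x y) _.
by apply: lerD; rewrite ?lerD2r ltW// distrC.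
Qed.

Lemma ext_rel_uniq x z w : ext_rel x z -> ext_rel x w -> z = w.
Proof.
move=> xz xw; apply/eqP; rewrite -subr_eq0 -normr_le0.
by apply: le_trans (ext_rel_dist xz xw) _; rewrite subrr normr0.
Qed.

Lemma ext_rel_lin a x y z w :
  ext_rel x z -> ext_rel y w -> ext_rel (a *: x + y) (a *: z + w).
Proof.
move=> xz yw r r0; have a0 : 0 < `|a| + 1 by rewrite ltr_wpDl.
have r2 : 0 < r / 2 by rewrite divr_gt0.
have [s [xs zs]] := xz (r / 2 / (`|a| + 1)) (divr_gt0 r2 a0).
have [t [yt wt]] := yw (r / 2) r2.
have D (L : hilbertType R) (g : I -> L) u v :
    `|u - lin_comb g s| < r / 2 / (`|a| + 1) -> `|v - lin_comb g t| < r / 2 ->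
    `|a *: u + v - lin_comb g (scale_comb a s ++ t)| < r.
  move=> us vt; rewrite comb_cat comb_scale opprD addrACA -scalerBr.
  rewrite (splitr r) (le_lt_trans (ler_normD _ _))//; apply: ler_ltD => //.
  rewrite normrZ (@le_trans _ _ ((`|a| + 1) * `|u - lin_comb g s|))//.
    by rewrite ler_wpM2r// lerDl.
  by rewrite mulrC -ler_pdivlMr// ltW.
by exists (scale_comb a s ++ t); split; exact: D.
Qed.

Lemma ext_rel1 i : ext_rel (e i) (f i).
Proof.
by move=> r r0; exists [:: (1, i)]; rewrite !comb1 !subrr !normr0 r0.
Qed.
End Extension.

Lemma linear_isometry_dot (H K : hilbertType R) (u : H -> K) :
  linear u -> (forall x, '[u x, u x] = '[x, x]) -> forall x y, '[u x, u y] = '[x, y].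
Proof.
move=> ul un x y.
have u_D a b : u (a + b) = u a + u b by have := ul 1 a b; rewrite !scale1r.
have u_Z c a : u (c *: a) = c *: u a.
  have u00 : u 0 = 0 by have := ul (-1) 0 0; rewrite !scaleN1r oppr0 addr0 addNr.
  by have := ul c a 0; rewrite u00 !addr0.
have P a b : '[u a, u b] + '[u b, u a] = '[a, b] + '[b, a].
  have := un (a + b); rewrite u_D !linearDl !linearDr/= !un.
  by rewrite -!addrA => /addrI; rewrite !addrA => /addIr.
have P1 := P x y; have := P ('i *: x) y.
rewrite u_Z !linearZl_LR !linearZr_LR/= conjCi !mulNr -!mulrBr.
move=> /(mulfI (neq0Ci _)) P2.
have : '[u x, u y] *+ 2 = '[x, y] *+ 2.
  have E (p q : C) : p *+ 2 = (p + q) + (p - q) by rewrite addrACA subrr addr0 mulr2n.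
  by rewrite (E _ '[u y, u x]) P1 P2 -E.
by move=> /eqP; rewrite -subr_eq0 -mulrnBl mulrn_eq0/= subr_eq0 => /eqP.
Qed.

Lemma unitary_ex (H K : hilbertType R) I (e : I -> H) (f : I -> K) :
  densely_spans e -> densely_spans f -> (forall i j, '[f i, f j] = '[e i, e j]) ->
  exists u : unitary H K, forall i, u (e i) = f i.
Proof.
move=> te tf gram.
pose u z := sval (cid (ext_rel_ex gram (te z))).
have uE z : ext_rel e f z (u z) by exact: svalP (cid (ext_rel_ex gram (te z))).
have uU z w : ext_rel e f z w -> u z = w by exact: (ext_rel_uniq gram).
have ul : linear u by move=> a x y; apply: uU; exact: ext_rel_lin.
have sym (L M : hilbertType R) (g : I -> L) (h : I -> M) z w : ext_rel g h z w -> ext_rel h g w z.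
  by move=> gh r /gh[s []]; exists s.
have e00 : ext_rel e f 0 0.
  by move=> r r0; exists [::]; rewrite /lin_comb !big_nil !subrr !normr0.
have un x : '[u x, u x] = '[x, x].
  rewrite -!sqr_norm_hdot; congr (_ ^+ 2); apply/le_anti/andP; split.
    by have := ext_rel_dist gram (uE x) e00; rewrite !subr0.
  have := ext_rel_dist (fun i j => esym (gram i j)) (sym _ _ _ _ _ _ (uE x)) (sym _ _ _ _ _ _ e00).
  by rewrite !subr0.
have us y : exists x, u x = y.
  have [x yx] := ext_rel_ex (fun i j => esym (gram i j)) (tf y).
  by exists x; apply: uU; exact: sym.
exists (Unitary ul (linear_isometry_dot ul un) us) => i /=.
by apply: uU; exact: ext_rel1.
Qed.

Lemma unitaryP (H K : hilbertType R) (u v : unitary H K) : u =1 v -> u = v.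
Proof.
case: u v => [u u1 u2 u3] [v v1 v2 v3] /= /funext uv.
by case: v / uv v1 v2 v3 => v1 v2 v3; congr Unitary; exact: Prop_irrelevance.
Qed.

Lemma unitary_norm (H K : hilbertType R) (u : unitary H K) x : `|u x| = `|x|.
Proof. by apply/eqP; rewrite -(@eqrXn2 _ 2)// !sqr_norm_hdot unitary_dot. Qed.

Lemma unitaryB (H K : hilbertType R) (u : unitary H K) x y : u (x - y) = u x - u y.
Proof. by rewrite addrC -scaleN1r unitary_linear scaleN1r addrC. Qed.

Lemma unitary_inj (H K : hilbertType R) (u : unitary H K) : injective u.
Proof.
move=> x y uxy; apply/eqP; rewrite -subr_eq0 -normr_eq0 -(unitary_norm u).
by rewrite unitaryB uxy subrr normr0.
Qed.

Lemma unitary_comb (H K : hilbertType R) (u : unitary H K) I (e : I -> H) s :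
  u (lin_comb e s) = lin_comb (u \o e) s.
Proof.
have u00 : u 0 = 0 by rewrite -(subrr 0) unitaryB subrr.
elim: s => [|p s IH]; first by rewrite /lin_comb !big_nil.
by rewrite /lin_comb !big_cons/= unitary_linear; congr (_ + _).
Qed.

Lemma unitary_ext (H K : hilbertType R) I (e : I -> H) (u v : unitary H K) :
  densely_spans e -> (forall i, u (e i) = v (e i)) -> u = v.
Proof.
move=> te uv; apply: unitaryP => z; apply/eqP; rewrite -subr_eq0 -normr_le0.
apply/ler_addgt0Pr => r r0; rewrite add0r.
have [s zs] := te z (r / 2) (divr_gt0 r0 (ltr0n _ 2)).
rewrite -(subrK (u (lin_comb e s)) (u z)) -addrA (splitr r) (le_trans (ler_normD _ _))//.
apply: lerD; first by rewrite -unitaryB unitary_norm ltW.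
have -> : u (lin_comb e s) = v (lin_comb e s).
  by rewrite !unitary_comb; congr lin_comb; apply/funext => i /=; exact: uv.
by rewrite -unitaryB unitary_norm distrC ltW.
Qed.

Lemma total_surj (H : hilbertType R) I J (e : I -> H) (f : J -> H) :
  densely_spans e -> (forall i, exists j, f j = e i) -> densely_spans f.
Proof.
by move=> te fe; apply: (total_trans te) => i; have [j <-] := fe i; exact: approx1.
Qed.

End Unitary.

Section TensorProduct.
Variable R : realType.
Local Notation C := R[i]%C.

(* A Hilbert space tensor product: these properties determine it up to a unique
   unitary compatible with the pure tensors. *)
Record hilbert_tensor (H K : hilbertType R) := HilbertTensor {
  tensor_space : hilbertType R;
  tensor_pure : H -> K -> tensor_space;
  tensor_pure_linearl : forall y, linear (tensor_pure^~ y);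
  tensor_pure_linearr : forall x, linear (tensor_pure x);
  tensor_pure_dot : forall x x' y y',
    '[tensor_pure x y, tensor_pure x' y'] = '[x, x'] * '[y, y'];
  tensor_pure_total : densely_spans (fun p : H * K => tensor_pure p.1 p.2) }.

Section Existence.
Variables (H K : hilbertType R).

Lemma alg_pure_subproof x y : (finrank_fun [:: (x, y)] : K -> H) \in @finrank R H K.
Proof. by apply/asboolP; exists [:: (x, y)]. Qed.

Definition alg_pure (x : H) (y : K) : alg_tensor H K :=
  exist _ (finrank_fun [:: (x, y)]) (alg_pure_subproof x y).

Lemma finrank_fun1 (x : H) (y z : K) : finrank_fun [:: (x, y)] z = '[y, z] *: x.
Proof. by rewrite /finrank_fun big_seq1. Qed.

Lemma alg_pure_linearl y : linear (alg_pure^~ y).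
Proof.
move=> a x x'; apply/val_inj/funext => z.
rewrite -[RHS]/(a *: finrank_fun [:: (x, y)] z + finrank_fun [:: (x', y)] z).
by rewrite /= !finrank_fun1 scalerDr !scalerA mulrC.
Qed.

Lemma alg_pure_linearr x : linear (alg_pure x).
Proof.
move=> a y y'; apply/val_inj/funext => z.
rewrite -[RHS]/(a *: finrank_fun [:: (x, y)] z + finrank_fun [:: (x, y')] z).
by rewrite /= !finrank_fun1 linearDl/= linearZl_LR/= scalerDl scalerA.
Qed.

Lemma alg_pure_dot x x' y y' :
  alg_dot (alg_pure x y) (alg_pure x' y') = '[x, x'] * '[y, y'].
Proof.
rewrite (@alg_dotE _ _ _ _ _ [:: (x', y')])// /fdot big_seq1/= finrank_fun1.
by rewrite linearZl_LR mulrC.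
Qed.

Lemma alg_pure_span f : exists s : seq (H * K), f = \sum_(p <- s) alg_pure p.1 p.2.
Proof.
have [s fs] := finrankP f; exists s; apply: val_inj; rewrite fs.
elim: s {fs} => [|p s IH]; apply/funext => y.
  by rewrite big_nil /finrank_fun big_nil.
rewrite big_cons.
rewrite -[RHS]/(finrank_fun [:: (p.1, p.2)] y + val (\sum_(j <- s) alg_pure j.1 j.2) y).
by rewrite -IH finrank_fun1 /finrank_fun big_cons.
Qed.

Local Notation ehat := (@embed _ _ (@alg_dot R H K)).

Lemma embed_pure_total :
  densely_spans (fun p : H * K => ehat (alg_pure p.1 p.2)).
Proof.
move=> z r r0; have [f zf] := embed_dense z r0.
have [s fs] := alg_pure_span f; exists [seq (1, p) | p <- s].
suff -> : lin_comb (fun p : H * K => ehat (alg_pure p.1 p.2)) [seq (1, p) | p <- s] = ehat f.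
  exact: zf.
rewrite fs /lin_comb big_map; elim: s {fs} => [|p s IH].
  rewrite !big_nil; apply/esym/eqP.
  have := embed_linear (@alg_dot R H K) (-1) 0 0; rewrite !scaleN1r oppr0 addr0 addNr.
  by move=> ->.
by rewrite !big_cons/= IH -[alg_pure _ _ in RHS]scale1r embed_linear.
Qed.

Lemma hilbert_tensor_exists : hilbert_tensor H K.
Proof.
exists (completion (@alg_dot R H K)) (fun x y => ehat (alg_pure x y)).
- by move=> y a x x'; rewrite alg_pure_linearl embed_linear.
- by move=> x a y y'; rewrite alg_pure_linearr embed_linear.
- by move=> x x' y y'; exact: etrans (cdot_embed (@alg_dot R H K) _ _) (alg_pure_dot _ _ _ _).
- exact: embed_pure_total.
Qed.

Definition tensor : hilbertType R := tensor_space hilbert_tensor_exists.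

Definition tens : H -> K -> tensor := tensor_pure hilbert_tensor_exists.

Lemma tens_dot x x' y y' : '[tens x y, tens x' y'] = '[x, x'] * '[y, y'].
Proof. exact: tensor_pure_dot. Qed.

Lemma tens_linearl y : linear (tens^~ y). Proof. exact: tensor_pure_linearl. Qed.

Lemma tens_linearr x : linear (tens x). Proof. exact: tensor_pure_linearr. Qed.

Lemma tens_total : densely_spans (fun p : H * K => tens p.1 p.2).
Proof. exact: tensor_pure_total. Qed.

Lemma tens_norm x y : `|tens x y| = `|x| * `|y|.
Proof.
apply/eqP; rewrite -(@eqrXn2 _ 2) ?mulr_ge0//.
by rewrite exprMn !sqr_norm_hdot tens_dot.
Qed.
End Existence.
End TensorProduct.

Declare Scope hilbert_scope.
Delimit Scope hilbert_scope with hilb.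
Bind Scope hilbert_scope with hilbertType.
Notation "H ⊗ K" := (tensor H K) (at level 40, left associativity) : hilbert_scope.
Notation "''U' ( H )" := (unitary H%hilb H%hilb) (format "''U' ( H )") : type_scope.

Section UnitaryAlgebra.
Variable R : realType.
Implicit Types H K L : hilbertType R.
Local Open Scope hilbert_scope.

Definition unitary1 H : 'U(H).
Proof. by exists id => // y; exists y. Defined.

Definition unitary_comp H K L (u : unitary K L) (v : unitary H K) : unitary H L.
Proof.
exists (u \o v) => [a x y|x y|z] /=.
- by rewrite !unitary_linear.
- by rewrite !unitary_dot.
- by have [y <-] := unitary_surj u z; have [x <-] := unitary_surj v y; exists x.
Defined.

Lemma unitary_inv_exists H K (u : unitary H K) :
  exists v : unitary K H, cancel u v /\ cancel v u.
Proof.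
pose v y := sval (cid (unitary_surj u y)).
have uK y : u (v y) = y by exact: svalP (cid (unitary_surj u y)).
have vl : linear v.
  by move=> a x y; apply: (@unitary_inj _ _ _ u); rewrite unitary_linear !uK.
have vd x y : '[v x, v y] = '[x, y] by rewrite -(unitary_dot u) !uK.
have vK x : v (u x) = x by apply: (@unitary_inj _ _ _ u); rewrite uK.
by exists (Unitary vl vd (fun x => ex_intro _ (u x) (vK x))).
Qed.

(* The inverse of a unitary is its adjoint, see [unitary_adjoint]. *)
Definition unitary_inv H K (u : unitary H K) : unitary K H :=
  sval (cid (unitary_inv_exists u)).

Lemma unitaryK H K (u : unitary H K) : cancel u (unitary_inv u).
Proof. by rewrite /unitary_inv; case: cid => v []. Qed.

Lemma unitaryVK H K (u : unitary H K) : cancel (unitary_inv u) u.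
Proof. by rewrite /unitary_inv; case: cid => v []. Qed.

Lemma unitary_adjoint H K (u : unitary H K) x y :
  '[u x, y] = '[x, unitary_inv u y].
Proof. by rewrite -{1}[y](unitaryVK u) unitary_dot. Qed.

Lemma unitary_tens_exists H H' K K' (u : unitary H H') (v : unitary K K') :
  exists w : unitary (H ⊗ K) (H' ⊗ K'), forall p : H * K,
    w (tens p.1 p.2) = tens (u p.1) (v p.2).
Proof.
apply: (@unitary_ex _ _ _ _ _ (fun p => tens (u p.1) (v p.2))).
- exact: tens_total.
- apply: (total_surj (@tens_total R H' K')) => -[x y] /=.
  have [x' <-] := unitary_surj u x; have [y' <-] := unitary_surj v y.
  by exists (x', y').
- by move=> p q; rewrite !tens_dot !unitary_dot.
Qed.

Definition unitary_tens H H' K K' (u : unitary H H') (v : unitary K K') :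
  unitary (H ⊗ K) (H' ⊗ K') := sval (cid (unitary_tens_exists u v)).

Lemma unitary_tensE H H' K K' (u : unitary H H') (v : unitary K K') x y :
  unitary_tens u v (tens x y) = tens (u x) (v y).
Proof. exact: (svalP (cid (unitary_tens_exists u v)) (x, y)). Qed.

Lemma flip_exists H K : exists w : unitary (H ⊗ K) (K ⊗ H), forall p : H * K,
  w (tens p.1 p.2) = tens p.2 p.1.
Proof.
apply: (@unitary_ex _ _ _ _ _ (fun p => tens p.2 p.1)).
- exact: tens_total.
- by apply: (total_surj (@tens_total R K H)) => -[y x]; exists (x, y).
- by move=> p q; rewrite !tens_dot mulrC.
Qed.

Definition tensor_flip H K : unitary (H ⊗ K) (K ⊗ H) := sval (cid (flip_exists H K)).

Lemma tensor_flipE H K (x : H) (y : K) : tensor_flip H K (tens x y) = tens y x.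
Proof. exact: (svalP (cid (flip_exists H K)) (x, y)). Qed.

Lemma approx_linear H K I (e : I -> H) (f : H -> K) (c : R[i]%C) (z : H) :
  linear f -> (forall x, `|f x| = `|x| * c) -> in_closed_span e z -> in_closed_span (f \o e) (f z).
Proof.
move=> fl fc ez r r0.
have c0 : 0 <= `|c| by exact: normr_ge0.
have c1 : 0 < `|c| + 1 by rewrite ltr_wpDl.
have [s zs] := ez (r / (`|c| + 1)) (divr_gt0 r0 c1).
have f0 : f 0 = 0 by have := fl (-1) 0 0; rewrite !scaleN1r oppr0 addr0 addNr.
have fs : f (lin_comb e s) = lin_comb (f \o e) s.
  elim: s {zs} => [|p s IH]; first by rewrite /lin_comb !big_nil.
  by rewrite /lin_comb !big_cons/= fl; congr (_ + _).
exists s; rewrite -fs.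
have -> : f z - f (lin_comb e s) = f (z - lin_comb e s).
  by have := fl (-1) (lin_comb e s) z; rewrite !scaleN1r ![- _ + _]addrC.
rewrite -[ltLHS]normr_id fc normrM normr_id.
rewrite (@le_lt_trans _ _ (`|z - lin_comb e s| * (`|c| + 1)))//.
  by rewrite ler_wpM2l// lerDl.
by rewrite -ltr_pdivlMr.
Qed.

Lemma tens3l_total H K L : densely_spans (fun p : H * K * L => tens (tens p.1.1 p.1.2) p.2).
Proof.
apply: (total_trans (@tens_total R (H ⊗ K) L)) => -[t z] /=.
have fc (x : H ⊗ K) : `|tens x z| = `|x| * `|z| by exact: tens_norm.
have A := approx_linear (tens_linearl z) fc (tens_total t).
move=> r /A[s ts]; exists [seq (p.1, (p.2, z)) | p <- s].
by rewrite /lin_comb big_map.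
Qed.

Lemma tens3r_total H K L : densely_spans (fun p : H * K * L => tens p.1.1 (tens p.1.2 p.2)).
Proof.
apply: (total_trans (@tens_total R H (K ⊗ L))) => -[x t] /=.
have fc (y : K ⊗ L) : `|tens x y| = `|y| * `|x| by rewrite mulrC; exact: tens_norm.
have A := approx_linear (tens_linearr x) fc (tens_total t).
move=> r /A[s ts]; exists [seq (p.1, ((x, p.2.1), p.2.2)) | p <- s].
by rewrite /lin_comb big_map.
Qed.

Lemma assoc_exists H K L : exists w : unitary (H ⊗ K ⊗ L) (H ⊗ (K ⊗ L)),
  forall p : H * K * L, w (tens (tens p.1.1 p.1.2) p.2) = tens p.1.1 (tens p.1.2 p.2).
Proof.
apply: (@unitary_ex _ _ _ _ _ (fun p => tens p.1.1 (tens p.1.2 p.2))).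
- exact: tens3l_total.
- exact: tens3r_total.
- by move=> p q; rewrite !tens_dot mulrA.
Qed.

Definition tensor_assoc H K L : unitary (H ⊗ K ⊗ L) (H ⊗ (K ⊗ L)) :=
  sval (cid (assoc_exists H K L)).

Lemma tensor_assocE H K L (x : H) (y : K) (z : L) :
  tensor_assoc H K L (tens (tens x y) z) = tens x (tens y z).
Proof. exact: (svalP (cid (assoc_exists H K L)) (x, y, z)). Qed.

End UnitaryAlgebra.

Declare Scope unitary_scope.
Delimit Scope unitary_scope with U.
Bind Scope unitary_scope with unitary.
Notation "1" := (unitary1 _) : unitary_scope.
Notation "u * v" := (unitary_comp u v) : unitary_scope.
Notation "u ^*" := (unitary_inv u) : unitary_scope.
Notation "u ^-1" := (unitary_inv u) (only parsing) : unitary_scope.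
Notation "u ⊗ v" := (unitary_tens u v) : unitary_scope.

Section Legs.
Variable R : realType.
Implicit Types A B C D : hilbertType R.
Local Open Scope hilbert_scope.
Local Open Scope unitary_scope.

(* Leg numbering: iterated tensor products are nested to the left, so that
   A ⊗ B ⊗ C is (A ⊗ B) ⊗ C. *)
Definition leg12 A B A' B' C (u : unitary (A ⊗ B) (A' ⊗ B')) :
  unitary (A ⊗ B ⊗ C) (A' ⊗ B' ⊗ C) := u ⊗ unitary1 C.

Definition leg23 A B C B' C' (u : unitary (B ⊗ C) (B' ⊗ C')) :
  unitary (A ⊗ B ⊗ C) (A ⊗ B' ⊗ C') :=
  (tensor_assoc A B' C')^-1 * (unitary1 A ⊗ u) * tensor_assoc A B C.

Definition leg13 A B C (u : 'U(A ⊗ C)) : 'U(A ⊗ B ⊗ C) :=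
  leg23 A (tensor_flip C B) * leg12 B u * leg23 A (tensor_flip B C).

Lemma leg12_inj A B A' B' C (c : C) : c != 0 ->
  injective (@leg12 A B A' B' C).
Proof.
move=> c0 u v uv; apply: unitaryP => t.
have : leg12 C u (tens t c) = leg12 C v (tens t c) by rewrite uv.
rewrite /leg12 !unitary_tensE/= => /eqP; rewrite -subr_eq0 -normr_eq0.
have -> : tens (u t) c - tens (v t) c = tens (u t - v t) c.
  by have := tens_linearl c (-1) (v t) (u t); rewrite /= !scaleN1r ![- _ + _]addrC.
by rewrite tens_norm mulf_eq0 !normr_eq0 (negPf c0) orbF subr_eq0 => /eqP.
Qed.

Lemma leg13_inj A B C (b : B) : b != 0 -> injective (@leg13 A B C).
Proof.
move=> b0 u v; rewrite /leg13; move: (leg23 A (tensor_flip B C)) (leg23 A (tensor_flip C B)) => a a' uv.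
apply: (leg12_inj b0); apply: unitaryP => t.
have := congr1 (fun w : 'U(A ⊗ B ⊗ C) => w (a^*%U t)) uv.
by rewrite /= !unitaryVK => /unitary_inj.
Qed.

(* Operators on A ⊗ B ⊗ C ⊗ D, seen on the tensor product of A ⊗ B and C ⊗ D. *)
Definition legs4 A B C D (u : 'U(A ⊗ B ⊗ C ⊗ D)) : 'U((A ⊗ B) ⊗ (C ⊗ D)) :=
  tensor_assoc (A ⊗ B) C D * u * (tensor_assoc (A ⊗ B) C D)^-1.

Definition leg13_of4 A B C D (u : 'U(A ⊗ C)) : 'U(A ⊗ B ⊗ C ⊗ D) := leg12 D (leg13 B u).
Definition leg23_of4 A B C D (u : 'U(B ⊗ C)) : 'U(A ⊗ B ⊗ C ⊗ D) := leg12 D (leg23 A u).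
Definition leg24_of4 A B C D (u : 'U(B ⊗ D)) : 'U(A ⊗ B ⊗ C ⊗ D) := leg13 C (leg23 A u).
Definition leg34_of4 A B C D (u : 'U(C ⊗ D)) : 'U(A ⊗ B ⊗ C ⊗ D) := leg23 (A ⊗ B) u.
End Legs.

Section MultiplicativeUnitaries.
Variable R : realType.
Local Open Scope hilbert_scope.
Local Open Scope unitary_scope.

Definition multiplicative_unitary (H : hilbertType R) (W : 'U(H ⊗ H)) :=
  leg23 H W * leg12 H W = leg12 H W * leg13 H W * leg23 H W.

Definition bicharacter (H1 H2 : hilbertType R)
    (W1 : 'U(H1 ⊗ H1)) (W2 : 'U(H2 ⊗ H2)) (X : 'U(H1 ⊗ H2)) :=
  leg23 H1 X * leg12 H2 W1 = leg12 H2 W1 * leg13 H1 X * leg23 H1 X /\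
  leg23 H1 W2 * leg12 H2 X = leg12 H2 X * leg13 H2 X * leg23 H1 W2.

(* [composite X Y P]: P is the composite of X and Y; see [composite_uniq]. *)
Definition composite (H1 H2 H3 : hilbertType R)
    (X : 'U(H1 ⊗ H2)) (Y : 'U(H2 ⊗ H3)) (P : 'U(H1 ⊗ H3)) :=
  leg23 H1 Y * leg12 H3 X = leg12 H3 X * leg13 H2 P * leg23 H1 Y.

Lemma composite_uniq (H1 H2 H3 : hilbertType R) (h : H2)
    (X : 'U(H1 ⊗ H2)) (Y : 'U(H2 ⊗ H3)) (P P' : 'U(H1 ⊗ H3)) : h != 0 ->
  composite X Y P -> composite X Y P' -> P = P'.
Proof.
move=> h0; rewrite /composite => -> XYP; apply: (leg13_inj h0); move: XYP.
move: (leg12 H3 X) (leg23 H1 Y) (leg13 H2 P) (leg13 H2 P') => x y p p' xyp.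
apply: unitaryP => t; have := congr1 (fun w : 'U(H1 ⊗ H2 ⊗ H3) => w (y^*%U t)) xyp.
by rewrite /= !unitaryVK => /unitary_inj.
Qed.

Section Braiding.
Variables (H L K : hilbertType R).
Variables (W : 'U(H ⊗ H)) (V : 'U(H ⊗ L)) (S : 'U(K ⊗ H)).

Definition right_representation :=
  leg23 K W * leg12 H S = leg12 H S * leg13 H S * leg23 K W.

Definition braiding_unitary (Z : 'U(K ⊗ L)) :=
  leg13 H Z = leg23 K V * leg12 L S^* * leg23 K V^* * leg12 L S.

Lemma braiding_unitary_uniq (h : H) Z Z' : h != 0 ->
  braiding_unitary Z -> braiding_unitary Z' -> Z = Z'.
Proof. by move=> h0 ZE Z'E; apply: (leg13_inj h0); rewrite ZE Z'E. Qed.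

(* If no Z exists, the value is meaningless; existence is [bmu_braiding] below. *)
Definition braiding : unitary (L ⊗ K) (K ⊗ L) :=
  (if pselect (exists Z, braiding_unitary Z) is left ex then sval (cid ex) else 1)
  * tensor_flip L K.
End Braiding.

Record braided_multiplicative_unitary (H L : hilbertType R) (W : 'U(H ⊗ H))
    (U : 'U(L ⊗ H)) (V : 'U(H ⊗ L)) (F : 'U(L ⊗ L)) : Prop := {
  bmu_mult : multiplicative_unitary W;
  bmu_right : right_representation W U;
  bmu_left : leg23 H V * leg12 L W = leg12 L W * leg13 H V * leg23 H V;
  bmu_YD : leg12 H V * leg13 L W * leg23 H U = leg23 H U * leg13 L W * leg12 H V;
  bmu_U_F : leg13 L U * leg23 L U * leg12 H F = leg12 H F * leg13 L U * leg23 L U;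
  bmu_V_F : leg13 L V * leg12 L V * leg23 H F = leg23 H F * leg13 L V * leg12 L V;
  bmu_braiding : forall (K : hilbertType R) (S : 'U(K ⊗ H)),
    right_representation W S -> exists Z, braiding_unitary V S Z;
  bmu_pentagon : let c := braiding V U in
    leg23 L F * leg12 L F =
    leg12 L F * leg23 L c * leg12 L F * leg23 L c^-1 * leg23 L F }.

Section Composites.
Variables (H L : hilbertType R).
Variables (W : 'U(H ⊗ H)) (U : 'U(L ⊗ H)) (V : 'U(H ⊗ L)) (F : 'U(L ⊗ L)).

Definition semidirect_unitary : 'U((H ⊗ L) ⊗ (H ⊗ L)) :=
  legs4 (leg13_of4 L L W * leg23_of4 H L U *
    leg34_of4 H L V^* * leg24_of4 H H F * leg34_of4 H L V).

Definition projection_unitary : 'U((H ⊗ L) ⊗ (H ⊗ L)) :=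
  legs4 (leg13_of4 L L W * leg23_of4 H L U).

(* W_13 U_23 and W_12, with H ⊗ L regarded as a single leg. *)
Definition to_base : 'U((H ⊗ L) ⊗ H) := leg13 L W * leg23 H U.

Definition from_base : 'U(H ⊗ (H ⊗ L)) :=
  tensor_assoc H H L * leg12 L W * (tensor_assoc H H L)^-1.
End Composites.
End MultiplicativeUnitaries.

(* Main.v *)
Require Import Defs.
From mathcomp Require Import all_boot all_order all_algebra.
From mathcomp Require Import complex.
From mathcomp Require Import all_classical all_reals.

Set Implicit Arguments.
Unset Strict Implicit.
Unset Printing Implicit Defensive.

Local Open Scope hilbert_scope.
Local Open Scope unitary_scope.

(* Write W^C = P F', with F' = V*_34 F_24 V_34; below, legs in blocks refer to the
   factors H ⊗ L. The relations of W and U give P_23 P_12 = P_12 P_13 P_23, and F'_12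
   commutes with P_13 P_23 by the Yetter-Drinfeld relation and the U-equivariance of F.
   In the pentagon of W^C, moving P_23 through F'_13 conjugates F_26 by V*_56 Z_46 V*_36,
   where Z is the braiding unitary; all factors P and V_56 then cancel, and there remains
   F_46 F'_12 = F'_12 Z_46 V*_36 F_26 V_36 Z*_46 F_46. Multiplying by V_36 V_34 and using
   that it commutes with F_46 and that V_36 V_34 Z_46 = Z_46 V_34 V_36 turns this into
   the braided pentagon equation of F. *)

(** * Composition, inverses and naturality for unitaries between tensor products *)

Section UnitaryLemmas.
Variable R : realType.
Implicit Types A B C D : hilbertType R.

Lemma in_closed_span_trans A I J (e : I -> A) (f : J -> A) z :
  in_closed_span e z -> (forall i, in_closed_span f (e i)) -> in_closed_span f z.
Proof.
move=> ez fe; apply: approx_limit => r r0; have [s zs] := ez _ r0.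
exists (lin_comb e s) => //; apply: approx_sum => p.
by rewrite -[(_ *: _)%R]GRing.addr0; apply: approx_lin => //; exact: approx0.
Qed.

(** Fixing one vector makes [tens] a linear map that scales norms by a constant, so approximation
    can be done in one factor at a time. *)
Lemma tens_total_pair A B I J (e : I -> A) (f : J -> B) :
  densely_spans e -> densely_spans f ->
  densely_spans (fun p : I * J => tens (e p.1) (f p.2)).
Proof.
move=> te tf; apply: (total_trans (@tens_total R A B)) => -[x y] /=.
have nr (z : B) : (`|tens x z| = `|z| * `|x|)%R by rewrite tens_norm GRing.mulrC.
have := approx_linear (tens_linearr x) nr (tf y).
move=> /in_closed_span_trans; apply => j /=.
have nl (z : A) : (`|tens z (f j)| = `|z| * `|f j|)%R by exact: tens_norm.
have := approx_linear (tens_linearl (f j)) nl (te x).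
move=> /in_closed_span_trans; apply => i /=.
exact: (@approx1 _ _ _ (fun p : I * J => tens (e p.1) (f p.2)) (i, j)).
Qed.

Lemma unitary_compA A B C D (u : unitary C D) (v : unitary B C) (w : unitary A B) :
  u * v * w = u * (v * w).
Proof. exact: unitaryP. Qed.

Lemma unitary_mulV A B (u : unitary A B) : u * u^* = 1.
Proof. by apply: unitaryP => z /=; rewrite unitaryVK. Qed.

Lemma unitary_mulVl A B (u : unitary A B) : u^* * u = 1.
Proof. by apply: unitaryP => z /=; rewrite unitaryK. Qed.

Lemma unitary_mulr1 A B (u : unitary A B) : u * 1 = u.
Proof. exact: unitaryP. Qed.

Lemma unitary_mul1r A B (u : unitary A B) : 1 * u = u.
Proof. exact: unitaryP. Qed.

Lemma unitary_mulI A B C (u v : unitary B C) (e : unitary A B) :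
  u * e = v * e -> u = v.
Proof.
move=> uv; apply: unitaryP => z.
by rewrite -(unitaryVK e z) -[LHS]/((u * e) _) uv.
Qed.

Lemma unitary_cancelr A B C (u : unitary B C) (v : unitary A B) (w : unitary B A) :
  v * w = 1 -> u * v * w = u.
Proof. by move=> vw; rewrite unitary_compA vw unitary_mulr1. Qed.

Lemma unitary_invE A B (u : unitary A B) (v : unitary B A) : u * v = 1 -> u^* = v.
Proof.
move=> uv; apply: unitaryP => z; apply: (@unitary_inj _ _ _ u).
by rewrite unitaryVK -[RHS]/((u * v) z) uv.
Qed.

Lemma tens_unitary_ext A B C (u v : unitary (A ⊗ B) C) :
  (forall x y, u (tens x y) = v (tens x y)) -> u = v.
Proof. by move=> uv; apply: (unitary_ext (@tens_total R A B)) => -[]. Qed.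

Lemma unitary_tensM A A' A'' B B' B'' (u : unitary A' A'') (u' : unitary A A')
    (v : unitary B' B'') (v' : unitary B B') :
  (u * u') ⊗ (v * v') = (u ⊗ v) * (u' ⊗ v').
Proof. by apply: tens_unitary_ext => x y /=; rewrite !unitary_tensE. Qed.

Lemma unitary_tens1 A B : unitary1 A ⊗ unitary1 B = 1.
Proof. by apply: tens_unitary_ext => x y /=; rewrite unitary_tensE. Qed.

Lemma tensor_flipK A B : tensor_flip B A * tensor_flip A B = 1.
Proof. by apply: tens_unitary_ext => x y /=; rewrite !tensor_flipE. Qed.

Lemma tensor_flip_nat A A' B B' (u : unitary A A') (v : unitary B B') :
  tensor_flip A' B' * (u ⊗ v) = (v ⊗ u) * tensor_flip A B.
Proof.
by apply: tens_unitary_ext => x y /=; rewrite unitary_tensE !tensor_flipE unitary_tensE.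
Qed.

Lemma tensor_assoc_nat A A' B B' C C' (u : unitary A A') (v : unitary B B')
    (w : unitary C C') :
  tensor_assoc A' B' C' * ((u ⊗ v) ⊗ w) = (u ⊗ (v ⊗ w)) * tensor_assoc A B C.
Proof.
apply: (unitary_ext (@tens3l_total R A B C)) => -[[x y] z] /=.
by rewrite !(unitary_tensE, tensor_assocE).
Qed.

Lemma tensor_assocVE A B C (x : A) (y : B) (z : C) :
  (tensor_assoc A B C)^* (tens x (tens y z)) = tens (tens x y) z.
Proof. by rewrite -tensor_assocE unitaryK. Qed.

Lemma leg23M A B C B' C' B'' C'' (u : unitary (B' ⊗ C') (B'' ⊗ C''))
    (v : unitary (B ⊗ C) (B' ⊗ C')) : leg23 A (u * v) = leg23 A u * leg23 A v.
Proof.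
apply: unitaryP => z /=; rewrite unitaryVK.
congr (_ _); rewrite -[RHS]/(((1 ⊗ u) * (1 ⊗ v)) _).
by rewrite -unitary_tensM unitary_mul1r.
Qed.

End UnitaryLemmas.

(** * Tensor products over binary trees and operators placed on some of their legs *)

Section Trees.
Variables (R : realType) (I : eqType) (A : I -> hilbertType R).

(* A bracketed tensor product of spaces [A i]; the leaves name its legs. *)
Inductive tree := Leaf of I | Node of tree & tree.

Fixpoint leaves t : seq I :=
  match t with Leaf i => [:: i] | Node a b => leaves a ++ leaves b end.

Fixpoint space t : hilbertType R :=
  match t with Leaf i => A i | Node a b => space a ⊗ space b end.

(** The family [x] ranges over all of [I], so one [x] yields pure tensors of differently ordered and
    bracketed trees, and no permutation has to be named. *)
Fixpoint pure (x : forall i, A i) t : space t :=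
  match t with Leaf i => x i | Node a b => tens (pure x a) (pure x b) end.

Implicit Types (s t a b c d r : tree) (x y : forall i, A i).

Lemma pure_dot x y t :
  ('[pure x t, pure y t] = \prod_(i <- leaves t) '[x i, y i])%R.
Proof.
elim: t => [i|a IHa b IHb] /=; first by rewrite big_seq1.
by rewrite tens_dot IHa IHb big_cat.
Qed.

Lemma eq_pure x y t : {in leaves t, forall i, x i = y i} -> pure x t = pure y t.
Proof.
elim: t => [i|a IHa b IHb] /= xy; first by rewrite xy ?mem_head.
by congr tens; [apply: IHa|apply: IHb] => i it; rewrite xy// mem_cat it ?orbT.
Qed.

(** Distinct leaves allow the vectors on the two branches to be chosen independently and then glued
    into one family. *)
Lemma pure_total t : uniq (leaves t) -> densely_spans (pure^~ t).
Proof.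
elim: t => [i _|a IHa b IHb] /=.
  apply: (total_surj (@approx1 _ _ _ id)) => z.
  have [x xi] : exists x : forall j, A j, x i = z.
    (* The family is [z], transported along [i = j], at the index [i], and 0 elsewhere. *)
    exists (fun j => if @eqP _ i j is ReflectT ij then ecast k (A k) ij z else 0%R).
    by case: eqP => // e; rewrite eq_axiomK.
  by exists x.
rewrite cat_uniq => /and3P[ua /hasPn ab ub].
apply: (total_surj (tens_total_pair (IHa ua) (IHb ub))) => -[x y] /=.
exists (fun i => if i \in leaves a then x i else y i); congr tens; apply: eq_pure => i.
  by move=> ->.
by move=> /ab/negPf ->.
Qed.

Definition reorders s t (e : unitary (space s) (space t)) :=
  [/\ uniq (leaves s), perm_eq (leaves s) (leaves t) &
      forall x, e (pure x s) = pure x t].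

Lemma reorder_ext s (B : hilbertType R) (e f : unitary (space s) B) :
  uniq (leaves s) -> (forall x, e (pure x s) = f (pure x s)) -> e = f.
Proof. by move=> us; apply: unitary_ext; exact: pure_total. Qed.

(** By [pure_dot] the Gram matrix of the pure tensors is a product over the leaves, hence blind to
    their order; total families with equal Gram matrices are related by a unitary. *)
Lemma reorder_exists s t : uniq (leaves s) -> perm_eq (leaves s) (leaves t) ->
  exists e : unitary (space s) (space t), reorders e.
Proof.
move=> us st.
have [||x y|e eE] := @unitary_ex R (space s) (space t) _ (pure^~ s) (pure^~ t).
- exact: pure_total.
- by apply: pure_total; rewrite -(perm_uniq st).
- by rewrite !pure_dot; exact/esym/perm_big.
- by exists e.
Qed.

Lemma reorders1 s : uniq (leaves s) -> @reorders s s 1.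
Proof. by split. Qed.

Lemma reordersM s t r (e : unitary (space t) (space r)) (f : unitary (space s) (space t)) :
  reorders e -> reorders f -> reorders (e * f).
Proof.
move=> [_ tr eE] [us st fE]; split=> //; first exact: perm_trans st tr.
by move=> x /=; rewrite fE eE.
Qed.

Lemma reordersV s t (e : unitary (space s) (space t)) : reorders e -> reorders e^*.
Proof.
move=> [us st eE]; split; [by rewrite -(perm_uniq st)|by rewrite perm_sym|].
by move=> x; rewrite -eE unitaryK.
Qed.

Lemma reorders_tensl s t r (e : unitary (space s) (space t)) :
  uniq (leaves s ++ leaves r) -> reorders e ->
  @reorders (Node s r) (Node t r) (e ⊗ 1).
Proof.
move=> us [_ st eE]; split=> //=; first by rewrite perm_cat2r.
by move=> x; rewrite unitary_tensE eE.
Qed.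

Lemma reorders_flip a b : uniq (leaves a ++ leaves b) ->
  @reorders (Node a b) (Node b a) (tensor_flip (space a) (space b)).
Proof.
move=> u; split=> //=; first by rewrite perm_catC.
by move=> x; rewrite tensor_flipE.
Qed.

Lemma reorders_assoc a b c : uniq ((leaves a ++ leaves b) ++ leaves c) ->
  @reorders (Node (Node a b) c) (Node a (Node b c))
    (tensor_assoc (space a) (space b) (space c)).
Proof.
move=> u; split=> //=; first by rewrite catA.
by move=> x; rewrite tensor_assocE.
Qed.

(* [w] is [u] acting on the legs of [s], and trivially on the other legs of [t]. *)
Definition placed s t (u : 'U(space s)) (w : 'U(space t)) :=
  forall r (e : unitary (space (Node s r)) (space t)), reorders e ->
    w * e = e * (u ⊗ 1).

(** Two arrangements with the legs of [s] in front differ by some [1 ⊗ c] on the remaining legs,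
    which commutes with [u ⊗ 1]; so a single arrangement decides. *)
Lemma placed_of s t (u : 'U(space s)) (w : 'U(space t)) r
    (e : unitary (space (Node s r)) (space t)) :
  reorders e -> w * e = e * (u ⊗ 1) -> placed u w.
Proof.
move=> re we r' f rf.
have [/= usr' _ _] := rf.
have rfe := reordersM (reordersV re) rf.
have rr' : perm_eq (leaves r') (leaves r).
  by have [_ + _] := rfe; rewrite /= perm_cat2l.
have [c [_ _ cE]] : exists c : unitary (space r') (space r), reorders c.
  by apply: reorder_exists => //; move: usr'; rewrite cat_uniq => /and3P[].
have -> : f = e * (1 ⊗ c).
  apply: (@reorder_ext (Node s r') _ _ _ usr') => x /=.
  have [_ _ ->] := rf; have [_ _ eE] := re.
  by rewrite unitary_tensE cE /= -[RHS]/(e (pure x (Node s r))) eE.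
rewrite -unitary_compA we !unitary_compA -!unitary_tensM.
by rewrite !(unitary_mul1r, unitary_mulr1).
Qed.

Lemma placed_exists s t (u : 'U(space s)) : exists w : 'U(space t), placed u w.
Proof.
have [[r [e re]]|ne] :=
  pselect (exists r (e : unitary (space (Node s r)) (space t)), reorders e).
  exists (e * (u ⊗ 1) * e^*); apply: (placed_of re).
  by rewrite !unitary_compA unitary_mulVl unitary_mulr1.
(* Without any arrangement [placed] holds vacuously, and 1 is an arbitrary value. *)
by exists 1 => r e re; case: ne; exists r, e.
Qed.

(* Meaningful only if [fits s t]: some leg of [t] must remain outside [s]. *)
Definition place s t (u : 'U(space s)) : 'U(space t) := sval (cid (placed_exists t u)).

Lemma placeP s t (u : 'U(space s)) r (e : unitary (space (Node s r)) (space t)) :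
  reorders e -> place t u * e = e * (u ⊗ 1).
Proof. exact: (svalP (cid (placed_exists t u))). Qed.

Lemma placeE s t (u : 'U(space s)) (w : 'U(space t)) r
    (e : unitary (space (Node s r)) (space t)) :
  reorders e -> w * e = e * (u ⊗ 1) -> w = place t u.
Proof. by move=> re we; apply: (@unitary_mulI _ _ _ _ _ _ e); rewrite we placeP. Qed.

(** The inequality is strict because [tree] has no empty tensor product: the complementary tree [r]
    has at least one leaf. *)
Definition fits s t := [&& uniq (leaves t), uniq (leaves s),
  all (mem (leaves t)) (leaves s) & (size (leaves s) < size (leaves t))%N].

Lemma leaves_gt0 t : (0 < size (leaves t))%N.
Proof. by elim: t => //= a IHa b IHb; rewrite size_cat addn_gt0 IHa. Qed.

Lemma fits_left a b : uniq (leaves (Node a b)) -> fits a (Node a b).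
Proof.
rewrite /fits /= => uab; rewrite uab; move: uab; rewrite cat_uniq => /andP[-> _] /=.
rewrite size_cat -[ltnLHS]addn0 ltn_add2l leaves_gt0 andbT.
by apply/allP => i; rewrite inE mem_cat => ->.
Qed.

Lemma fits_right a b : uniq (leaves (Node a b)) -> fits b (Node a b).
Proof.
rewrite /fits /= => uab; rewrite uab; move: uab; rewrite cat_uniq => /and3P[_ _ ->] /=.
rewrite size_cat -[ltnLHS]add0n ltn_add2r leaves_gt0 andbT.
by apply/allP => i; rewrite inE mem_cat orbC => ->.
Qed.

Lemma fits_trans s t r : fits s t -> fits t r -> fits s r.
Proof.
move=> /and4P[_ us /allP st lst] /and4P[ur _ /allP tr ltr].
rewrite /fits ur us (ltn_trans lst ltr) andbT; apply/allP => i /st; exact: tr.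
Qed.

Lemma fits_perm s t t' : perm_eq (leaves t) (leaves t') -> fits s t = fits s t'.
Proof.
move=> p; rewrite /fits (perm_uniq p) (perm_size p); congr [&& _, _, _ & _].
by apply: eq_all => i; exact: perm_mem.
Qed.

Lemma fits_middle a b c : uniq (leaves (Node (Node a b) c)) ->
  fits (Node b c) (Node (Node a b) c) /\ fits (Node a c) (Node (Node a b) c).
Proof.
move=> u; split.
  rewrite (@fits_perm _ _ (Node a (Node b c))) /= ?catA//.
  by apply: fits_right; rewrite /= catA.
have p : perm_eq (leaves (Node (Node a b) c)) (leaves (Node (Node a c) b)).
  by rewrite /= -!catA perm_cat2l perm_catC.
by rewrite (fits_perm _ p); apply: fits_left; rewrite -(perm_uniq p).
Qed.

Fixpoint comb i l := if l is j :: l' then Node (Leaf i) (comb j l') else Leaf i.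

Lemma leaves_comb i l : leaves (comb i l) = i :: l.
Proof. by elim: l i => //= j l IH i; rewrite IH. Qed.

Lemma fitsP s t : fits s t ->
  exists r (e : unitary (space (Node s r)) (space t)), reorders e.
Proof.
move=> /and4P[ut us /allP st lt].
pose l := [seq i <- leaves t | i \notin leaves s].
have p : perm_eq (leaves s ++ l) (leaves t).
  apply: uniq_perm => // [|i].
    rewrite cat_uniq us filter_uniq// andbT; apply/hasPn => i.
    by rewrite mem_filter => /andP[].
  rewrite mem_cat mem_filter; case: (boolP (i \in leaves s)) => [/st/= it|//].
  by rewrite [RHS]it.
have : size l != 0%N.
  apply: contraTneq lt => l0; rewrite -leqNgt.
  by rewrite -(perm_size p) size_cat l0 addn0.
case E : l => [//|i l'] _; exists (comb i l').
have p' : perm_eq (leaves (Node s (comb i l'))) (leaves t).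
  by rewrite /= leaves_comb -E.
by apply: reorder_exists; rewrite // (perm_uniq p').
Qed.

Lemma placeM s t : fits s t -> forall u v : 'U(space s),
  place t (u * v) = place t u * place t v.
Proof.
move=> /fitsP[r [e re]] u v; apply/esym/(placeE re).
rewrite unitary_compA (placeP v re) -unitary_compA (placeP u re) unitary_compA.
by rewrite -unitary_tensM unitary_mul1r.
Qed.

Lemma place1 s t : fits s t -> place t (unitary1 (space s)) = 1.
Proof.
move=> /fitsP[r [e re]]; apply/esym/(placeE re).
by rewrite unitary_tens1 unitary_mul1r unitary_mulr1.
Qed.

Lemma placeV s t : fits s t -> forall u : 'U(space s), place t u^* = (place t u)^*.
Proof.
by move=> st u; apply/esym/unitary_invE; rewrite -placeM// unitary_mulV place1.
Qed.

(** If [t] is rearranged as [Node s a] and [r] as [Node t b], then [r] is a rearrangement of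
    [Node s (Node a b)]; naturality of the associator turns [(u ⊗ 1) ⊗ 1] into [u ⊗ 1]. *)
Lemma place_place s t r (u : 'U(space s)) : fits s t -> fits t r ->
  place r (place t u) = place r u.
Proof.
move=> /fitsP[a [e re]] /fitsP[b [f rf]].
have ua : uniq ((leaves s ++ leaves a) ++ leaves b).
  have [/= utb _ _] := rf; have [_ + _] := re => /= p.
  by rewrite (perm_uniq (_ : perm_eq _ (leaves t ++ leaves b)))// perm_cat2r.
have rg := reordersM (reordersM rf (@reorders_tensl (Node s a) t b e ua re))
  (reordersV (reorders_assoc ua)).
apply: (placeE rg).
rewrite -!unitary_compA (placeP _ rf) [f * _ * (_ ⊗ _)]unitary_compA -unitary_tensM.
rewrite (placeP _ re) !unitary_compA; congr (_ * _).
rewrite unitary_tensM unitary_compA; congr (_ * _).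
apply: (@unitary_mulI _ _ _ _ _ _ (tensor_assoc (space s) (space a) (space b))).
rewrite !unitary_compA unitary_mulVl unitary_mulr1 -unitary_tens1.
by rewrite -tensor_assoc_nat -unitary_compA unitary_mulVl unitary_mul1r.
Qed.

Lemma place_reorder s t r (e : unitary (space t) (space r)) :
  fits s t -> reorders e -> forall u : 'U(space s), e * place t u * e^* = place r u.
Proof.
move=> /fitsP[a [f rf]] re u; apply: (placeE (reordersM re rf)).
rewrite !unitary_compA -[in LHS](unitary_compA e^*) unitary_mulVl unitary_mul1r.
by rewrite (placeP u rf).
Qed.

Lemma place_left a b (u : 'U(space a)) : uniq (leaves a ++ leaves b) ->
  u ⊗ 1 = place (Node a b) u.
Proof.
move=> uab; apply: (placeE (@reorders1 (Node a b) uab)).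
by rewrite unitary_mul1r unitary_mulr1.
Qed.

(** [placed] wants the active legs in front, hence the flip. *)
Lemma place_right a b (u : 'U(space b)) : uniq (leaves a ++ leaves b) ->
  1 ⊗ u = place (Node a b) u.
Proof.
rewrite uniq_catC => uab; apply: (placeE (reorders_flip uab)).
exact/esym/tensor_flip_nat.
Qed.

(** [u ⊗ 1] and [1 ⊗ v] commute on [Node s s'], and this is carried over to [t]. *)
Lemma place_comm s s' t (u : 'U(space s)) (v : 'U(space s')) :
  fits s t -> fits s' t -> uniq (leaves s ++ leaves s') ->
  place t u * place t v = place t v * place t u.
Proof.
move=> st s't uss'.
have C : (u ⊗ 1) * (1 ⊗ v) = (1 ⊗ v) * (u ⊗ 1 : 'U(space (Node s s'))).
  by rewrite -!unitary_tensM !(unitary_mul1r, unitary_mulr1).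
have [fs fs'] := (@fits_left s s' uss', @fits_right s s' uss').
rewrite (place_left u uss') (place_right v uss') in C.
(* [s] and [s'] may exhaust the legs of [t]; then [place_place] does not apply. *)
have [lt|le] := ltnP (size (leaves s ++ leaves s')) (size (leaves t)).
  have ft : fits (Node s s') t.
    move: st s't; rewrite /fits /= lt uss' => /and4P[-> _ + _] /and4P[_ _ + _].
    by rewrite all_cat => -> ->.
  by rewrite -(place_place u fs ft) -(place_place v fs' ft) -!placeM// C.
have [e re] : exists e : unitary (space (Node s s')) (space t), reorders e.
  apply: reorder_exists => //.
  have /and4P[ut _ /allP at_s _] := st; have /and4P[_ _ /allP at_s' _] := s't.
  apply: uniq_perm => //; apply: (uniq_min_size uss' _ le).2 => i.
  by rewrite mem_cat => /orP[/at_s|/at_s'].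
rewrite -(place_reorder fs re u) -(place_reorder fs' re v).
by apply: unitaryP => z /=; rewrite !unitaryK -[LHS]/(e ((_ * _) _)) C.
Qed.

(** * Leg-numbered operators as placements *)

Lemma leg12_place a b c (u : 'U(space (Node a b))) :
  uniq (leaves (Node (Node a b) c)) ->
  leg12 (space c) u = place (Node (Node a b) c) u.
Proof. exact: (@place_left (Node a b) c u). Qed.

Lemma leg23_place a b c (u : 'U(space (Node b c))) :
  uniq (leaves (Node (Node a b) c)) ->
  leg23 (space a) u = place (Node (Node a b) c) u.
Proof.
move=> uabc; rewrite /leg23 unitary_compA.
have uabc' : uniq (leaves a ++ leaves (Node b c)) by rewrite /= catA.
have ra := reordersV (@reorders_assoc a b c uabc).
rewrite (@place_right a (Node b c) u uabc').
rewrite -(place_reorder (@fits_right a (Node b c) uabc') ra u) unitary_compA.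
by congr (_ * (_ * _)); apply/esym/unitary_invE; rewrite unitary_mulVl.
Qed.

Lemma reorders_leg23_flip a b c : uniq (leaves (Node (Node a b) c)) ->
  @reorders (Node (Node a b) c) (Node (Node a c) b)
    (leg23 (space a) (tensor_flip (space b) (space c))).
Proof.
move=> uabc; split=> //=; first by rewrite -!catA perm_cat2l perm_catC.
move=> x; rewrite tensor_assocE unitary_tensE tensor_flipE.
exact: tensor_assocVE.
Qed.

Lemma leg23_flipK (B C D : hilbertType R) :
  leg23 B (tensor_flip C D) * leg23 B (tensor_flip D C) = 1.
Proof.
apply: (unitary_ext (@tens3l_total R B D C)) => -[[x y] z] /=.
rewrite tensor_assocE unitary_tensE tensor_flipE tensor_assocVE.
by rewrite tensor_assocE unitary_tensE tensor_flipE tensor_assocVE.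
Qed.

(** [leg13] conjugates by the flip of the last two legs, a reordering that brings [a] and [c]
    together in front. *)
Lemma leg13_place a b c (u : 'U(space (Node a c))) :
  uniq (leaves (Node (Node a b) c)) ->
  leg13 (space b) u = place (Node (Node a b) c) u.
Proof.
move=> uabc; have uacb : uniq (leaves (Node (Node a c) b)).
  by rewrite /= -(perm_uniq (_ : perm_eq ((leaves a ++ leaves b) ++ leaves c) _))//
    -!catA perm_cat2l perm_catC.
apply: (placeE (reorders_leg23_flip uacb)).
exact: (unitary_cancelr _ (leg23_flipK (space a) (space b) (space c))).
Qed.

(** With its two companions and [placeM], this carries an identity in leg notation on three factors
    to legs of a bigger tree. *)
Lemma place_leg12 a b c t : fits (Node (Node a b) c) t -> forall u : 'U(space (Node a b)),
  place t (leg12 (space c) u : 'U(space (Node (Node a b) c))) = place t u.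
Proof.
move=> f u; have /and4P[_ uabc _ _] := f.
by rewrite (leg12_place u uabc) (place_place u (@fits_left (Node a b) c uabc) f).
Qed.

Lemma place_leg23 a b c t : fits (Node (Node a b) c) t -> forall u : 'U(space (Node b c)),
  place t (leg23 (space a) u : 'U(space (Node (Node a b) c))) = place t u.
Proof.
move=> f u; have /and4P[_ uabc _ _] := f.
by rewrite (leg23_place u uabc) (place_place u (fits_middle uabc).1 f).
Qed.

Lemma place_leg13 a b c t : fits (Node (Node a b) c) t -> forall u : 'U(space (Node a c)),
  place t (leg13 (space b) u : 'U(space (Node (Node a b) c))) = place t u.
Proof.
move=> f u; have /and4P[_ uabc _ _] := f.
by rewrite (leg13_place u uabc) (place_place u (fits_middle uabc).2 f).
Qed.

Lemma legs4_place a b c d s : fits s (Node (Node (Node a b) c) d) ->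
  forall u : 'U(space s),
  legs4 (place (Node (Node (Node a b) c) d) u) = place (Node (Node a b) (Node c d)) u.
Proof.
move=> st u; have /and4P[ut _ _ _] := st.
exact: place_reorder st (@reorders_assoc (Node a b) c d ut) u.
Qed.

End Trees.

(** * The operators of the theorem on numbered legs *)

Section BraidedLegs.
Variables (R : realType) (H L : hilbertType R).

(* The legs numbered 1, ..., 6 on paper are [(false, 0)], [(true, 0)], ..., [(false, 2)],
   [(true, 2)]: the boolean selects the space and the number the factor H ⊗ L. *)
Definition leg_space (i : bool * nat) : hilbertType R := if i.1 then L else H.

Local Notation h n := (Leaf (false, n)).
Local Notation l n := (Leaf (true, n)).
Local Notation place s := (@place R _ leg_space s).
Local Notation space := (space leg_space).

Variables (W : 'U(H ⊗ H)) (U : 'U(L ⊗ H)) (V : 'U(H ⊗ L)) (F Z : 'U(L ⊗ L)).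
Implicit Type T : tree (bool * nat)%type.

Definition Wleg T (i j : nat) : 'U(space T) := place (Node (h i) (h j)) T W.
Definition Uleg T (i j : nat) : 'U(space T) := place (Node (l i) (h j)) T U.
Definition Vleg T (i j : nat) : 'U(space T) := place (Node (h i) (l j)) T V.
Definition Fleg T (i j : nat) : 'U(space T) := place (Node (l i) (l j)) T F.
Definition Zleg T (i j : nat) : 'U(space T) := place (Node (l i) (l j)) T Z.

Hypothesis WUVF : braided_multiplicative_unitary W U V F.
Hypothesis VUZ : braiding_unitary V U Z.
Hypothesis FZ : leg23 L F * leg12 L F =
  leg12 L F * leg23 L Z * leg13 L F * leg23 L Z^* * leg23 L F.

(** * The defining relations on arbitrary legs, applied to a vector *)

Lemma place_eq s T (u v : 'U(space s)) z : u = v -> place s T u z = place s T v z.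
Proof. by move=> ->. Qed.

Lemma leg_mult T i j k z : fits (Node (Node (h i) (h j)) (h k)) T ->
  Wleg T j k (Wleg T i j z) = Wleg T i j (Wleg T i k (Wleg T j k z)).
Proof.
move=> f; have := place_eq (s := Node (Node (h i) (h j)) (h k)) z (bmu_mult WUVF).
by rewrite !(place_leg12 f, place_leg13 f, place_leg23 f, placeM f).
Qed.

Lemma leg_right T i j k z : fits (Node (Node (l i) (h j)) (h k)) T ->
  Wleg T j k (Uleg T i j z) = Uleg T i j (Uleg T i k (Wleg T j k z)).
Proof.
move=> f; have := place_eq (s := Node (Node (l i) (h j)) (h k)) z (bmu_right WUVF).
by rewrite !(place_leg12 f, place_leg13 f, place_leg23 f, placeM f).
Qed.

Lemma leg_left T i j k z : fits (Node (Node (h i) (h j)) (l k)) T ->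
  Vleg T j k (Wleg T i j z) = Wleg T i j (Vleg T i k (Vleg T j k z)).
Proof.
move=> f; have := place_eq (s := Node (Node (h i) (h j)) (l k)) z (bmu_left WUVF).
by rewrite !(place_leg12 f, place_leg13 f, place_leg23 f, placeM f).
Qed.

Lemma leg_YD T i j k z : fits (Node (Node (h i) (l j)) (h k)) T ->
  Vleg T i j (Wleg T i k (Uleg T j k z)) = Uleg T j k (Wleg T i k (Vleg T i j z)).
Proof.
move=> f; have := place_eq (s := Node (Node (h i) (l j)) (h k)) z (bmu_YD WUVF).
by rewrite !(place_leg12 f, place_leg13 f, place_leg23 f, placeM f).
Qed.

Lemma leg_U_F T i j k z : fits (Node (Node (l i) (l j)) (h k)) T ->
  Uleg T i k (Uleg T j k (Fleg T i j z)) = Fleg T i j (Uleg T i k (Uleg T j k z)).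
Proof.
move=> f; have := place_eq (s := Node (Node (l i) (l j)) (h k)) z (bmu_U_F WUVF).
by rewrite !(place_leg12 f, place_leg13 f, place_leg23 f, placeM f).
Qed.

Lemma leg_V_F T i j k z : fits (Node (Node (h i) (l j)) (l k)) T ->
  Vleg T i k (Vleg T i j (Fleg T j k z)) = Fleg T j k (Vleg T i k (Vleg T i j z)).
Proof.
move=> f; have := place_eq (s := Node (Node (h i) (l j)) (l k)) z (bmu_V_F WUVF).
by rewrite !(place_leg12 f, place_leg13 f, place_leg23 f, placeM f).
Qed.

Lemma leg_braiding T i j k z : fits (Node (Node (l i) (h j)) (l k)) T ->
  Zleg T i k z = Vleg T j k ((Uleg T i j)^* ((Vleg T j k)^* (Uleg T i j z))).
Proof.
move=> f; have := place_eq (s := Node (Node (l i) (h j)) (l k)) z VUZ.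
have /and4P[_ u _ _] := f.
have fU : fits (Node (l i) (h j)) T.
  by apply: fits_trans f; exact: (@fits_left _ (Node (l i) (h j))).
have fV : fits (Node (h j) (l k)) T by apply: fits_trans f; exact: (fits_middle u).1.
rewrite !(place_leg12 f, place_leg13 f, place_leg23 f, placeM f).
by rewrite (placeV fV) (placeV fU).
Qed.

Lemma leg_F_Z T i j k z : fits (Node (Node (l i) (l j)) (l k)) T ->
  Fleg T j k (Fleg T i j z) =
  Fleg T i j (Zleg T j k (Fleg T i k ((Zleg T j k)^* (Fleg T j k z)))).
Proof.
move=> f; have := place_eq (s := Node (Node (l i) (l j)) (l k)) z FZ.
have /and4P[_ u _ _] := f.
have fZ : fits (Node (l j) (l k)) T by apply: fits_trans f; exact: (fits_middle u).1.
rewrite !(place_leg12 f, place_leg13 f, place_leg23 f, placeM f).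
by rewrite (placeV fZ).
Qed.

Lemma place_commE T s s' (u : 'U(space s)) (v : 'U(space s')) z :
  fits s T -> fits s' T -> uniq (leaves s ++ leaves s') ->
  place s T u (place s' T v z) = place s' T v (place s T u z).
Proof.
move=> sT s'T uss'.
by have := congr1 (fun w : 'U(space T) => w z) (place_comm u v sT s'T uss').
Qed.

Lemma unitary_commVE (A : hilbertType R) (u v : 'U(A)) :
  (forall z, u (v z) = v (u z)) -> forall z, u^* (v z) = v (u^* z).
Proof. by move=> uv z; apply: (@unitary_inj _ _ _ u); rewrite uv !unitaryVK. Qed.

(* For [i, j] = 0, 1 these are V*_34 F_24 V_34, P and W^C. *)
Definition FVleg T (i j : nat) : 'U(space T) := (Vleg T j j)^* * Fleg T i j * Vleg T j j.
Definition Pleg T (i j : nat) : 'U(space T) := Wleg T i j * Uleg T i j.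
Definition Cleg T (i j : nat) : 'U(space T) := Pleg T i j * FVleg T i j.

Lemma FVlegE T i j z : FVleg T i j z = (Vleg T j j)^* (Fleg T i j (Vleg T j j z)).
Proof. by []. Qed.

Lemma PlegE T i j z : Pleg T i j z = Wleg T i j (Uleg T i j z).
Proof. by []. Qed.

Lemma ClegE T i j z : Cleg T i j z = Pleg T i j (FVleg T i j z).
Proof. by []. Qed.

Definition HL (n : nat) : tree (bool * nat)%type := Node (h n) (l n).

(** Unlike [fits t T] this also holds for [T = t], so a lemma about the legs of [t] covers [t]
    itself as well as larger trees. *)
Definition contains T t := forall s, fits s t -> fits s T.

Lemma fits_contains T t : fits t T -> contains T t.
Proof. by move=> f s /fits_trans; apply. Qed.

(** W_13 U_23 is the tensor product of the right representations W and U, hence again a right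
    representation. *)
Lemma Pleg_right T z : contains T (Node (Node (HL 0) (h 1%N)) (h 2%N)) ->
  Wleg T 1 2 (Pleg T 0 1 z) = Pleg T 0 1 (Pleg T 0 2 (Wleg T 1 2 z)).
Proof.
move=> fitT; have WU y : Wleg T 0 2 (Uleg T 0 1 y) = Uleg T 0 1 (Wleg T 0 2 y).
  by apply: place_commE; rewrite ?fitT.
by rewrite !PlegE leg_mult ?fitT// leg_right ?fitT// WU.
Qed.

(** * Relations on the first five legs *)

Section FiveLegs.
Variable T : tree (bool * nat)%type.
Hypothesis fitT : contains T (Node (Node (HL 0) (HL 1)) (h 2%N)).

(** V_34 reverses the product W_35 U_45 by the Yetter-Drinfeld relation, F_24 then passes U_25 U_45
    by equivariance, and the inverse of V_34 restores the order. *)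
Lemma FVleg_comm z :
  FVleg T 0 1 (Uleg T 0 2 (Wleg T 1 2 (Uleg T 1 2 z))) =
  Uleg T 0 2 (Wleg T 1 2 (Uleg T 1 2 (FVleg T 0 1 z))).
Proof.
rewrite !FVlegE.
have VU y : Vleg T 1 1 (Uleg T 0 2 y) = Uleg T 0 2 (Vleg T 1 1 y).
  by apply: place_commE; rewrite ?fitT.
have FW y : Fleg T 0 1 (Wleg T 1 2 y) = Wleg T 1 2 (Fleg T 0 1 y).
  by apply: place_commE; rewrite ?fitT.
have YD y : (Vleg T 1 1)^* (Uleg T 1 2 (Wleg T 1 2 y)) =
    Wleg T 1 2 (Uleg T 1 2 ((Vleg T 1 1)^* y)).
  apply: (@unitary_inj _ _ _ (Vleg T 1 1)).
  by rewrite leg_YD ?fitT// !unitaryVK.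
rewrite VU leg_YD ?fitT//.
by rewrite -leg_U_F ?fitT// (unitary_commVE VU) FW YD.
Qed.

(** U_45 is disjoint from the legs 1, 2, 3 of the block operator P_12, so the claim reduces to
    [Pleg_right]. *)
Lemma Pleg_mult z :
  Pleg T 1 2 (Pleg T 0 1 z) = Pleg T 0 1 (Pleg T 0 2 (Pleg T 1 2 z)).
Proof.
have UW y : Uleg T 1 2 (Wleg T 0 1 y) = Wleg T 0 1 (Uleg T 1 2 y).
  by apply: place_commE; rewrite ?fitT.
have UU y : Uleg T 1 2 (Uleg T 0 1 y) = Uleg T 0 1 (Uleg T 1 2 y).
  by apply: place_commE; rewrite ?fitT.
have fitT' : contains T (Node (Node (HL 0) (h 1%N)) (h 2%N)).
  by move=> s fs; apply/fitT/(fits_trans fs).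
rewrite !PlegE UW UU; exact: (Pleg_right (Uleg T 1 2 z) fitT').
Qed.

Lemma FVleg_P z : FVleg T 0 1 (Pleg T 0 2 (Pleg T 1 2 z)) =
  Pleg T 0 2 (Pleg T 1 2 (FVleg T 0 1 z)).
Proof.
have VW y : Vleg T 1 1 (Wleg T 0 2 y) = Wleg T 0 2 (Vleg T 1 1 y).
  by apply: place_commE; rewrite ?fitT.
have FW y : Fleg T 0 1 (Wleg T 0 2 y) = Wleg T 0 2 (Fleg T 0 1 y).
  by apply: place_commE; rewrite ?fitT.
have := FVleg_comm z; rewrite !PlegE => <-.
by rewrite !FVlegE VW FW (unitary_commVE VW).
Qed.

(** As [P] meets only the [H] leg of its second block, five legs suffice; the same identity serves
    [to_base] and the projection. *)
Lemma Pleg_Cleg z : Pleg T 1 2 (Cleg T 0 1 z) = Cleg T 0 1 (Pleg T 0 2 (Pleg T 1 2 z)).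
Proof. by rewrite !ClegE Pleg_mult FVleg_P. Qed.

End FiveLegs.

Lemma FVleg_Wleg T z : contains T (Node (Node (h 0%N) (HL 1)) (HL 2)) ->
  FVleg T 1 2 (Wleg T 0 1 z) = Wleg T 0 1 (FVleg T 1 2 z).
Proof.
move=> fitT; have VW y : Vleg T 2 2 (Wleg T 0 1 y) = Wleg T 0 1 (Vleg T 2 2 y).
  by apply: place_commE; rewrite ?fitT.
have FW y : Fleg T 1 2 (Wleg T 0 1 y) = Wleg T 0 1 (Fleg T 1 2 y).
  by apply: place_commE; rewrite ?fitT.
by rewrite !FVlegE VW FW (unitary_commVE VW).
Qed.

(** Among the factors of W^C only W shares a leg with [Wleg T 0 1], so this comes down to the
    pentagon equation of W. *)
Lemma Cleg_Wleg T z : contains T (Node (Node (h 0%N) (HL 1)) (HL 2)) ->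
  Cleg T 1 2 (Wleg T 0 1 z) = Wleg T 0 1 (Wleg T 0 2 (Cleg T 1 2 z)).
Proof.
move=> fitT; have UW y : Uleg T 1 2 (Wleg T 0 1 y) = Wleg T 0 1 (Uleg T 1 2 y).
  by apply: place_commE; rewrite ?fitT.
by rewrite !ClegE FVleg_Wleg// !PlegE UW leg_mult ?fitT.
Qed.

(** * The pentagon equation of W^C on six legs *)

Section SixLegs.
Let T : tree (bool * nat)%type := Node (Node (HL 0) (HL 1)) (HL 2).

(* W_35 commutes with Z_46; the relations then carry W_35 V_34 V_36 through
   Z_46 = V_56 U*_45 V*_56 U_45 one factor at a time. *)
Lemma VV_Z z : Vleg T 1 2 (Vleg T 1 1 (Zleg T 1 2 z)) =
  Zleg T 1 2 (Vleg T 1 1 (Vleg T 1 2 z)).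
Proof.
have UV y : Uleg T 1 2 (Vleg T 1 2 y) = Vleg T 1 2 (Uleg T 1 2 y) by exact: place_commE.
have VV y : Vleg T 2 2 (Vleg T 1 1 y) = Vleg T 1 1 (Vleg T 2 2 y) by exact: place_commE.
have ZW y : Zleg T 1 2 (Wleg T 1 2 y) = Wleg T 1 2 (Zleg T 1 2 y) by exact: place_commE.
apply: (@unitary_inj _ _ _ (Wleg T 1 2)); rewrite -ZW.
rewrite !(@leg_braiding T 1%N 2%N 2%N)// -leg_YD// UV (unitary_commVE VV).
have -> y : (Vleg T 2 2)^* (Wleg T 1 2 (Vleg T 1 2 y)) = Wleg T 1 2 ((Vleg T 2 2)^* y).
  by apply: (@unitary_inj _ _ _ (Vleg T 2 2)); rewrite leg_left// !unitaryVK.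
have -> y : (Uleg T 1 2)^* (Vleg T 1 1 (Wleg T 1 2 y)) =
    Wleg T 1 2 (Vleg T 1 1 ((Uleg T 1 2)^* y)).
  by apply: (@unitary_inj _ _ _ (Uleg T 1 2)); rewrite -leg_YD// !unitaryVK.
by rewrite leg_left// VV.
Qed.

Lemma Fleg_FVleg z : Fleg T 1 2 (FVleg T 0 1 z) =
  FVleg T 0 1 (Zleg T 1 2 ((Vleg T 1 2)^* (Fleg T 0 2
    (Vleg T 1 2 ((Zleg T 1 2)^* (Fleg T 1 2 z)))))).
Proof.
have VF y : Vleg T 1 2 (Fleg T 0 1 y) = Fleg T 0 1 (Vleg T 1 2 y) by exact: place_commE.
have VF' y : Vleg T 1 1 (Fleg T 0 2 y) = Fleg T 0 2 (Vleg T 1 1 y) by exact: place_commE.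
have ZVV y : Vleg T 1 1 (Vleg T 1 2 ((Zleg T 1 2)^* y)) =
    (Zleg T 1 2)^* (Vleg T 1 2 (Vleg T 1 1 y)).
  by apply: (@unitary_inj _ _ _ (Zleg T 1 2)); rewrite -VV_Z !unitaryVK.
(* The factor V_36 V_34 commutes with F_46, and its V_34 cancels the inverse of V_34 in F'_12; then
   the braided pentagon [leg_F_Z] applies. *)
apply: (@unitary_inj _ _ _ (Vleg T 1 1)); apply: (@unitary_inj _ _ _ (Vleg T 1 2)).
rewrite leg_V_F// !FVlegE !unitaryVK !VF leg_F_Z//.
by rewrite VV_Z unitaryVK VF' ZVV leg_V_F.
Qed.

(** V_56 W_35 = W_35 V_36 V_56 and V_56 U_45 = U_45 Z*_46 V_56, while F_26 commutes with W_35 and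
    U_45; so passing P_23 only dresses F_26 with V_36, Z_46 and V_56. *)
Lemma FVleg_P12 z : FVleg T 0 2 (Pleg T 1 2 z) =
  Pleg T 1 2 ((Vleg T 2 2)^* (Zleg T 1 2 ((Vleg T 1 2)^* (Fleg T 0 2
    (Vleg T 1 2 ((Zleg T 1 2)^* (Vleg T 2 2 z))))))).
Proof.
rewrite !FVlegE !PlegE.
have FW y : Fleg T 0 2 (Wleg T 1 2 y) = Wleg T 1 2 (Fleg T 0 2 y) by exact: place_commE.
have UV y : Uleg T 1 2 (Vleg T 1 2 y) = Vleg T 1 2 (Uleg T 1 2 y) by exact: place_commE.
have UF y : Uleg T 1 2 (Fleg T 0 2 y) = Fleg T 0 2 (Uleg T 1 2 y) by exact: place_commE.
have VU y : Vleg T 2 2 (Uleg T 1 2 y) = Uleg T 1 2 ((Zleg T 1 2)^* (Vleg T 2 2 y)).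
  apply: (@unitary_inj _ _ _ (Uleg T 1 2)^*); apply: (@unitary_inj _ _ _ (Zleg T 1 2)).
  by rewrite (@leg_braiding T 1%N 2%N 2%N) ?unitaryVK ?unitaryK ?unitaryVK.
have V'U y : (Vleg T 2 2)^* (Uleg T 1 2 y) = Uleg T 1 2 ((Vleg T 2 2)^* (Zleg T 1 2 y)).
  by rewrite (@leg_braiding T 1%N 2%N 2%N)// unitaryK unitaryVK.
have V'W y : (Vleg T 2 2)^* (Wleg T 1 2 y) =
    Wleg T 1 2 ((Vleg T 2 2)^* ((Vleg T 1 2)^* y)).
  by apply: (@unitary_inj _ _ _ (Vleg T 2 2)); rewrite leg_left// !unitaryVK.
have V'UC y : (Vleg T 1 2)^* (Uleg T 1 2 y) = Uleg T 1 2 ((Vleg T 1 2)^* y).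
  by apply: unitary_commVE => x; rewrite UV.
by rewrite leg_left// VU -UV FW -UF V'W V'UC V'U.
Qed.

(** The legs 4, 5, 6 of F'_23 are disjoint from the legs 1, 2, 3 of P_12. *)
Lemma FVleg_P01 z : FVleg T 1 2 (Pleg T 0 1 z) = Pleg T 0 1 (FVleg T 1 2 z).
Proof.
have VU y : Vleg T 2 2 (Uleg T 0 1 y) = Uleg T 0 1 (Vleg T 2 2 y) by exact: place_commE.
have FU y : Fleg T 1 2 (Uleg T 0 1 y) = Uleg T 0 1 (Fleg T 1 2 y) by exact: place_commE.
rewrite !PlegE FVleg_Wleg; last exact: fits_contains.
by rewrite !FVlegE VU FU (unitary_commVE VU).
Qed.

Lemma Cleg_Pleg z : Cleg T 1 2 (Pleg T 0 1 z) = Pleg T 0 1 (Pleg T 0 2 (Cleg T 1 2 z)).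
Proof. by rewrite !ClegE FVleg_P01 Pleg_mult//; exact: fits_contains. Qed.

Lemma Cleg_mult z : Cleg T 1 2 (Cleg T 0 1 z) = Cleg T 0 1 (Cleg T 0 2 (Cleg T 1 2 z)).
Proof.
have fit5 : contains T (Node (Node (HL 0) (HL 1)) (h 2%N)) by exact: fits_contains.
have FVV y : FVleg T 0 1 ((Vleg T 2 2)^* y) = (Vleg T 2 2)^* (FVleg T 0 1 y).
  have VF x : Vleg T 2 2 (Fleg T 0 1 x) = Fleg T 0 1 (Vleg T 2 2 x) by exact: place_commE.
  have VV x : Vleg T 2 2 (Vleg T 1 1 x) = Vleg T 1 1 (Vleg T 2 2 x) by exact: place_commE.
  apply/esym/unitary_commVE => {}y; rewrite !FVlegE.
  by rewrite -VV -VF; apply/esym/unitary_commVE => x; rewrite VV.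
(* Both sides are brought to begin with the block product P_12 P_13 P_23. In the rest V_56 and its
   inverse move to the two ends, and [Fleg_FVleg] compares what lies between. *)
rewrite !ClegE FVleg_P01 Pleg_mult// FVleg_P12 FVleg_P// FVV.
have VFV x : Vleg T 2 2 (FVleg T 0 1 x) = FVleg T 0 1 (Vleg T 2 2 x).
  by apply: (@unitary_inj _ _ _ (Vleg T 2 2)^*); rewrite -FVV !unitaryK.
by rewrite !(@FVlegE T 1%N 2%N) VFV Fleg_FVleg unitaryVK.
Qed.

End SixLegs.

(** * Identification of W^C, P and the two bicharacters as placements *)

Lemma legs4M (A B C D : hilbertType R) (u v : 'U(A ⊗ B ⊗ C ⊗ D)) :
  legs4 (u * v) = legs4 u * legs4 v.
Proof.
apply: unitaryP => z /=.
by rewrite unitaryK.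
Qed.

Section Pairs.
Variables i j : nat.
Hypothesis ij : i != j.

Let ji : j != i. Proof. by rewrite eq_sym. Qed.

(** For variable [i] and [j], [uniq] and [fits] do not compute; these equations decide equality of
    leg names. *)
Let pairsE := (xpair_eqE, eqxx, negPf ij, negPf ji).

Let a := h i : tree (bool * nat)%type.
Let b := l i : tree (bool * nat)%type.
Let c := h j : tree (bool * nat)%type.
Let d := l j : tree (bool * nat)%type.
Let abc := Node (Node a b) c.
Let abcd := Node abc d.
Let uabcd : uniq (leaves abcd). Proof. by rewrite /= !inE !pairsE. Qed.
Let uabc : uniq (leaves abc). Proof. by rewrite /= !inE !pairsE. Qed.
Let uabd : uniq (leaves (Node (Node a b) d)). Proof. by rewrite /= !inE !pairsE. Qed.
Let uacd : uniq (leaves (Node (Node a c) d)). Proof. by rewrite /= !inE !pairsE. Qed.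

Lemma to_baseE : to_base W U = Pleg (Node (HL i) (h j)) i j.
Proof.
rewrite /to_base (@leg13_place _ _ leg_space a b c W uabc).
by rewrite (@leg23_place _ _ leg_space a b c U uabc).
Qed.

Lemma from_baseE : from_base L W = Wleg (Node (h i) (HL j)) i j.
Proof.
rewrite /from_base (@leg12_place _ _ leg_space a c d W uacd).
exact: (place_reorder (@fits_left _ (Node a c) d uacd)
  (@reorders_assoc _ _ leg_space a c d uacd) W).
Qed.

Lemma legs4_leg13 : legs4 (leg13_of4 L L W) = Wleg (Node (HL i) (HL j)) i j.
Proof.
have f := (fits_middle uabc).2; have f' := @fits_left _ abc d uabcd.
rewrite /leg13_of4 (@leg13_place _ _ leg_space a b c W uabc).
rewrite (@leg12_place _ _ leg_space (Node a b) c d _ uabcd) (place_place _ f f').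
exact: (legs4_place (A := leg_space) (fits_trans f f') W).
Qed.

Lemma legs4_leg23 : legs4 (leg23_of4 H L U) = Uleg (Node (HL i) (HL j)) i j.
Proof.
have f := (fits_middle uabc).1; have f' := @fits_left _ abc d uabcd.
rewrite /leg23_of4 (@leg23_place _ _ leg_space a b c U uabc).
rewrite (@leg12_place _ _ leg_space (Node a b) c d _ uabcd) (place_place _ f f').
exact: (legs4_place (A := leg_space) (fits_trans f f') U).
Qed.

Lemma legs4_leg34 (X : 'U(H ⊗ L)) :
  legs4 (leg34_of4 H L X) = place (Node c d) (Node (HL i) (HL j)) X.
Proof.
have f := (@fits_middle _ (Node a b) c d uabcd).1.
rewrite /leg34_of4 (@leg23_place _ _ leg_space (Node a b) c d X uabcd).
exact: (legs4_place (A := leg_space) f X).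
Qed.

Lemma legs4_leg24 : legs4 (leg24_of4 H H F) = Fleg (Node (HL i) (HL j)) i j.
Proof.
have f := (fits_middle uabd).1; have f' := (@fits_middle _ (Node a b) c d uabcd).2.
rewrite /leg24_of4 (@leg23_place _ _ leg_space a b d F uabd).
rewrite (@leg13_place _ _ leg_space (Node a b) c d _ uabcd) (place_place _ f f').
exact: (legs4_place (A := leg_space) (fits_trans f f') F).
Qed.

Let fit_ac : fits (Node a c) (Node (HL i) (HL j)).
Proof. by rewrite /fits /= !inE !pairsE. Qed.

Let fit_bc : fits (Node b c) (Node (HL i) (HL j)).
Proof. by rewrite /fits /= !inE !pairsE. Qed.

Let fit_bd : fits (Node b d) (Node (HL i) (HL j)).
Proof. by rewrite /fits /= !inE !pairsE. Qed.

Let fit_cd : fits (Node c d) (Node (HL i) (HL j)).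
Proof. by rewrite /fits /= !inE !pairsE. Qed.

Lemma projectionE : projection_unitary W U = Pleg (Node (HL i) (HL j)) i j.
Proof. by rewrite /projection_unitary legs4M legs4_leg13 legs4_leg23. Qed.

Lemma semidirectE : semidirect_unitary W U V F = Cleg (Node (HL i) (HL j)) i j.
Proof.
rewrite /semidirect_unitary !legs4M legs4_leg13 legs4_leg23 legs4_leg24 !legs4_leg34.
rewrite (placeV fit_cd).
exact: unitaryP.
Qed.

Lemma place_projection T : fits (Node (HL i) (HL j)) T ->
  place (Node (HL i) (HL j)) T (projection_unitary W U) = Pleg T i j.
Proof.
move=> f; rewrite projectionE (placeM f).
by rewrite (place_place _ fit_ac f) (place_place _ fit_bc f).
Qed.

Lemma place_semidirect T : fits (Node (HL i) (HL j)) T ->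
  place (Node (HL i) (HL j)) T (semidirect_unitary W U V F) = Cleg T i j.
Proof.
move=> f; rewrite semidirectE (placeM f) -projectionE place_projection//.
rewrite !(placeM f) (placeV f).
by rewrite (place_place _ fit_cd f) (place_place _ fit_bd f).
Qed.

Lemma place_to_base T : fits (Node (HL i) (h j)) T ->
  place (Node (HL i) (h j)) T (to_base W U) = Pleg T i j.
Proof.
have fac := (fits_middle uabc).2; have fbc := (fits_middle uabc).1.
by move=> f; rewrite to_baseE (placeM f) (place_place _ fac f) (place_place _ fbc f).
Qed.

Lemma place_from_base T : fits (Node (h i) (HL j)) T ->
  place (Node (h i) (HL j)) T (from_base L W) = Wleg T i j.
Proof.
have fac : fits (Node a c) (Node (h i) (HL j)) by rewrite /fits /= !inE !pairsE.
by move=> f; rewrite from_baseE (place_place _ fac f).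
Qed.

End Pairs.

(** Every condition of the theorem is a composite: [multiplicative_unitary W] is [composite W W W],
    and [bicharacter W1 W2 X] is [composite W1 X X] together with [composite X W2 X]. *)
Lemma composite_place a b c (X : 'U(space (Node a b))) (Y : 'U(space (Node b c)))
    (P : 'U(space (Node a c))) (T := Node (Node a b) c) X' Y' P' :
  uniq (leaves T) ->
  place (Node a b) T X = X' -> place (Node b c) T Y = Y' -> place (Node a c) T P = P' ->
  (forall z, Y' (X' z) = X' (P' (Y' z))) ->
  @composite R (space a) (space b) (space c) X Y P.
Proof.
move=> u <- <- <- E; rewrite /composite.
rewrite (leg12_place X u) (leg13_place P u) (leg23_place Y u).
exact: unitaryP.
Qed.

Lemma projection_bicharacters :
  let WC := semidirect_unitary W U V F in let P := projection_unitary W U in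
  multiplicative_unitary WC /\
  [/\ bicharacter WC W (to_base W U),
      bicharacter W WC (from_base L W) &
      composite (to_base W U) (from_base L W) P] /\
  [/\ composite WC P P, composite P WC P & composite P P P].
Proof.
move=> WC P'; pose t6 : tree (bool * nat)%type := Node (Node (HL 0) (HL 1)) (HL 2).
pose t5 : tree (bool * nat)%type := Node (Node (HL 0) (HL 1)) (h 2%N).
pose t_XW : tree (bool * nat)%type := Node (Node (HL 0) (h 1%N)) (h 2%N).
pose t_WY : tree (bool * nat)%type := Node (Node (h 0%N) (h 1%N)) (HL 2).
pose t_YC : tree (bool * nat)%type := Node (Node (h 0%N) (HL 1)) (HL 2).
pose t_XY : tree (bool * nat)%type := Node (Node (HL 0) (h 1%N)) (HL 2).
have t6_t5 : contains t6 t5 by exact: fits_contains.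
have C i j T ij := @place_semidirect i j ij T.
have P i j T ij := @place_projection i j ij T.
have X i j T ij := @place_to_base i j ij T.
have Y i j T ij := @place_from_base i j ij T.
split; last split.
- apply: (@composite_place (HL 0) (HL 1) (HL 2) _ _ _ _ _ _ isT
    (C 0%N 1%N t6 isT isT) (C 1%N 2%N t6 isT isT) (C 0%N 2%N t6 isT isT)) => z.
  exact: Cleg_mult.
- split; [split|split|].
  + apply: (@composite_place (HL 0) (HL 1) (h 2%N) _ _ _ _ _ _ isT
      (C 0%N 1%N t5 isT isT) (X 1%N 2%N t5 isT isT) (X 0%N 2%N t5 isT isT)) => z.
    exact: Pleg_Cleg.
  (* [erefl] serves for [W] because [Wleg] is by definition a placement of it. *)
  + apply: (@composite_place (HL 0) (h 1%N) (h 2%N) _ W _ _ _ _ isT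
      (X 0%N 1%N t_XW isT isT) erefl (X 0%N 2%N t_XW isT isT)) => z.
    exact: Pleg_right.
  + apply: (@composite_place (h 0%N) (h 1%N) (HL 2) W _ _ _ _ _ isT
      erefl (Y 1%N 2%N t_WY isT isT) (Y 0%N 2%N t_WY isT isT)) => z.
    exact: leg_mult.
  + apply: (@composite_place (h 0%N) (HL 1) (HL 2) _ _ _ _ _ _ isT
      (Y 0%N 1%N t_YC isT isT) (C 1%N 2%N t_YC isT isT) (Y 0%N 2%N t_YC isT isT)) => z.
    exact: Cleg_Wleg.
  (* [to_base] and the projection both become [Pleg], and [from_base] becomes [Wleg], so the
     relation is again [Pleg_right], now with an idle leg [l 2]. *)
  + apply: (@composite_place (HL 0) (h 1%N) (HL 2) _ _ _ _ _ _ isT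
      (X 0%N 1%N t_XY isT isT) (Y 1%N 2%N t_XY isT isT) (P 0%N 2%N t_XY isT isT)) => z.
    by apply: Pleg_right; exact: fits_contains.
- split.
  + apply: (@composite_place (HL 0) (HL 1) (HL 2) _ _ _ _ _ _ isT
      (C 0%N 1%N t6 isT isT) (P 1%N 2%N t6 isT isT) (P 0%N 2%N t6 isT isT)) => z.
    exact: Pleg_Cleg.
  + apply: (@composite_place (HL 0) (HL 1) (HL 2) _ _ _ _ _ _ isT
      (P 0%N 1%N t6 isT isT) (C 1%N 2%N t6 isT isT) (P 0%N 2%N t6 isT isT)) => z.
    exact: Cleg_Pleg.
  + apply: (@composite_place (HL 0) (HL 1) (HL 2) _ _ _ _ _ _ isT
      (P 0%N 1%N t6 isT isT) (P 1%N 2%N t6 isT isT) (P 0%N 2%N t6 isT isT)) => z.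
    exact: Pleg_mult.
Qed.

End BraidedLegs.

(** For c = ZΣ, conjugating F_12 by c_23 gives Z_23 F_13 Z*_23, since [leg13] is by definition
    conjugation by the flip. *)
Lemma braiding_exists (R : realType) (H L : hilbertType R)
    (W : 'U(H ⊗ H)) (U : 'U(L ⊗ H)) (V : 'U(H ⊗ L)) (F : 'U(L ⊗ L)) :
  braided_multiplicative_unitary W U V F ->
  exists2 Z, braiding_unitary V U Z &
    leg23 L F * leg12 L F =
    leg12 L F * leg23 L Z * leg13 L F * leg23 L Z^* * leg23 L F.
Proof.
move=> WUVF; have [Z0 Z0E] := bmu_braiding WUVF (bmu_right WUVF).
have := bmu_pentagon WUVF; rewrite /= /braiding.
(* [U] is a right representation, so a braiding unitary exists and the default branch of [braiding]
   is excluded. The witness is the unitary chosen inside [braiding], the one that the pentagon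
   refers to. *)
case: pselect => [ex|[]]; last by exists Z0.
move: (svalP (cid ex)); move: (sval (cid ex)) => Z ZE.
rewrite (_ : (Z * tensor_flip L L)^* = tensor_flip L L * Z^*); last first.
  apply: unitary_invE; rewrite !unitary_compA -[in LHS](unitary_compA (tensor_flip L L)).
  by rewrite tensor_flipK unitary_mul1r unitary_mulV.
rewrite !leg23M => FE; exists Z => //; rewrite FE; exact: unitaryP.
Qed.

Theorem proposition3p5 (R : realType) (H L : hilbertType R)
    (W : 'U(H ⊗ H)) (U : 'U(L ⊗ H)) (V : 'U(H ⊗ L)) (F : 'U(L ⊗ L))
    (WUVF : braided_multiplicative_unitary W U V F) :
  let WC : 'U((H ⊗ L) ⊗ (H ⊗ L)) := semidirect_unitary W U V F in
  let P : 'U((H ⊗ L) ⊗ (H ⊗ L)) := projection_unitary W U in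
  multiplicative_unitary WC /\
  [/\ bicharacter WC W (to_base W U),
      bicharacter W WC (from_base L W) &
      composite (to_base W U) (from_base L W) P] /\
  [/\ leg23 (H ⊗ L) P * leg12 (H ⊗ L) WC =
        leg12 (H ⊗ L) WC * leg13 (H ⊗ L) P * leg23 (H ⊗ L) P,
      leg23 (H ⊗ L) WC * leg12 (H ⊗ L) P =
        leg12 (H ⊗ L) P * leg13 (H ⊗ L) P * leg23 (H ⊗ L) WC &
      leg23 (H ⊗ L) P * leg12 (H ⊗ L) P =
        leg12 (H ⊗ L) P * leg13 (H ⊗ L) P * leg23 (H ⊗ L) P].
Proof.
have [Z VUZ FZ] := braiding_exists WUVF.
exact: projection_bicharacters WUVF VUZ FZ.
Qed.
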